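(* Suppose $M$ is a simple $U(L)$-module which, by restriction, is a free $U(B)$-module of rank $1$. Then there exist $\alpha,\gamma\in\mathbb{C}$, $\beta,\lambda\in\mathbb{C}^*$ and $g\in\mathbb{C}[t]$ such that $M$ is isomorphic, as a $U(L)$-module, to $\Omega(\alpha,\beta,\gamma,\lambda,g)$.
   Context: $\mathbb{C}^*$ denotes the non-zero complex numbers. $L=\mathcal{W}\ltimes\widehat{H_4}$ is the complex Lie algebra with $\mathbb{C}$-basis $\{L_n,a_n,b_n,c_n,d_n\mid n\in\mathbb{Z}\}$ and non-vanishing brackets $[L_m,L_n]=(n-m)L_{m+n}$, $[L_m,x_n]=n\,x_{m+n}$ for $x\in\{a,b,c,d\}$, $[a_m,b_n]=c_{m+n}$, $[d_m,a_n]=a_{m+n}$, $[d_m,b_n]=-b_{m+n}$ (for $m,n\in\mathbb{Z}$). $U(\cdot)$ denotes the universal enveloping algebra. $B=\mathbb{C}L_0\oplus\mathbb{C}a_0$ is an (abelian) subalgebra of $L$. $\Omega(\alpha,\beta,\gamma,\lambda,g)$ is the polynomial space $\mathbb{C}[s,t]$ with the $U(L)$-action given, for $n\in\mathbb{Z}$ and $f(s,t)\in\mathbb{C}[s,t]$, by $$L_n f(s,t)=\lambda^n(s+n\alpha)f(s-n,t),$$ $$d_n f(s,t)=\lambda^n\beta^{-1}\left(tg(t)+\gamma\right)f(s-n,t)+\lambda^n t\,\partial_t f(s-n,t),$$ $$a_n f(s,t)=\lambda^n t f(s-n,t),$$ $$b_n f(s,t)=\lambda^n g(t) f(s-n,t)+\lambda^n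 \beta\, \partial_t f(s-n,t),$$ $$c_n f(s,t)=-\lambda^n\beta f(s-n,t).$$ *)

(* Defs.v *)
From HB Require Import structures.
From mathcomp Require Import all_boot all_order all_algebra finmap.
From mathcomp Require Import boolp reals complex.
From mathcomp.multinomials Require Import monalg.
From mathcomp Require Import ring.

Set Implicit Arguments.
Unset Strict Implicit.
Unset Printing Implicit Defensive.

Import GRing.Theory.
Local Open Scope ring_scope.
Local Open Scope quotient_scope.

Definition isomorphic (A : pzRingType) (M N : lmodType A) : Prop :=
  exists f : {linear M -> N}, bijective f.

Definition free_of_rank1 (A : nzRingType) (N : lmodType A) : Prop :=
  @isomorphic A A^o N.

(* Boolean predicates S suffice: in the presence of boolp every subset of M    *)
(* is one.                                                                    *)
Definition simple_module (A : pzRingType) (M : lmodType A) : Prop :=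
  (exists x : M, x != 0) /\
  forall S : {pred M}, GRing.submod_closed S ->
    S =i pred1 0 \/ S =i predT.

Definition restriction (A A' : pzRingType) (f : {rmorphism A -> A'})
  (M : lmodType A') : Type := M.

Section Restriction.
Variables (A A' : pzRingType) (f : {rmorphism A -> A'}) (M : lmodType A').
Local Notation N := (restriction f M).

HB.instance Definition _ := GRing.Zmodule.on N.

Definition restriction_scale (a : A) (v : N) : N :=
  f a *: (v : M).

Fact restriction_scaleA a b v :
  restriction_scale a (restriction_scale b v) = restriction_scale (a * b) v.
Proof. by rewrite /restriction_scale scalerA rmorphM. Qed.

Fact restriction_scale1 : left_id 1 restriction_scale.
Proof. by move=> v; rewrite /restriction_scale rmorph1 scale1r. Qed.

Fact restriction_scaleDr : right_distributive restriction_scale +%R.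
Proof. by move=> a u v; rewrite /restriction_scale scalerDr. Qed.

Fact restriction_scaleDl v :
  {morph restriction_scale^~ v : a b / a + b}.
Proof. by move=> a b; rewrite /restriction_scale rmorphD scalerDl. Qed.

HB.instance Definition _ := GRing.Zmodule_isLmodule.Build A N
  restriction_scaleA restriction_scale1 restriction_scaleDr restriction_scaleDl.

End Restriction.

HB.mixin Record Lmodule_isLieAlgebra (F : fieldType) V of GRing.Lmodule F V := {
  lie : V -> V -> V;
  lie_linearl : forall y, linear (lie^~ y);
  lie_linearr : forall x, linear (lie x);
  liexx : forall x, lie x x = 0;
  lie_jacobi : forall x y z,
    lie x (lie y z) + lie y (lie z x) + lie z (lie x y) = 0
}.

#[short(type="lieAlgType")]
HB.structure Definition LieAlgebra (F : fieldType) :=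
  { V of GRing.Lmodule F V & Lmodule_isLieAlgebra F V }.

Definition lie_morphism (F : fieldType) (L L' : lieAlgType F)
  (f : {linear L -> L'}) : Prop := forall x y, f (lie x y) = lie (f x) (f y).

Section LinearExtension.
Variables (F : fieldType) (K : choiceType) (V : lmodType F).
Variable h : K -> V.

(* The linear extension to {malg F[K]} of a map h given on the basis << k >>. *)
Definition linext (g : {malg F[K]}) : V := \sum_(k <- msupp g) g@_k *: h k.

Lemma linextEw (d : {fset K}) g : (msupp g `<=` d)%fset ->
  linext g = \sum_(k <- d) g@_k *: h k.
Proof.
move=> le; rewrite /linext (big_fset_incl _ le) => //= x xd /mcoeff_outdom ->.
by rewrite scale0r.
Qed.

Fact linext_is_linear : linear linext.
Proof.
move=> c g1 g2; set d := (msupp g1 `|` msupp g2 `|` msupp (c *: g1 + g2))%fset.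
have le1 : (msupp g1 `<=` d)%fset by rewrite /d -fsetUA fsubsetUl.
have le2 : (msupp g2 `<=` d)%fset by rewrite /d fsetUAC fsubsetUr.
rewrite (linextEw le1) (linextEw le2) (@linextEw d) ?fsubsetUr //.
rewrite scaler_sumr -big_split; apply: eq_bigr => k _ /=.
by rewrite mcoeffD mcoeffZ scalerDl scalerA.
Qed.

HB.instance Definition _ :=
  GRing.isLinear.Build F {malg F[K]} V *:%R linext linext_is_linear.

Lemma linextU k : linext << k >> = h k.
Proof.
by rewrite (linextEw (msuppU_le (K := K))) big_seq_fset1 mcoeffUU scale1r.
Qed.

End LinearExtension.

Lemma malgZU (F : fieldType) (K : choiceType) (c : F) (k : K) :
  << c *g k >> = c *: << k >> :> {malg F[K]}.
Proof. by apply/malgP=> i; rewrite mcoeffZ !mcoeffU mulrnAr mulr1. Qed.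

Lemma malg_linind (F : fieldType) (K : choiceType) (V : lmodType F)
  (f g : {malg F[K]} -> V) : linear f -> linear g ->
  (forall k, f << k >> = g << k >>) -> f =1 g.
Proof.
move=> lf lg fg x.
have f0 : f 0 = 0 by have := lf (-1) 0 0; rewrite scaler0 addr0 scaleN1r addNr.
have g0 : g 0 = 0 by have := lg (-1) 0 0; rewrite scaler0 addr0 scaleN1r addNr.
rewrite [x]monalgE; elim/big_rec: _ => [|k y _ IH]; first by rewrite f0 g0.
by rewrite malgZU lf lg fg IH.
Qed.

Fact malg_scaleAr (F : fieldType) (K : monomType) (c : F)
  (p q : {malg F[K]}) : c *: (p * q) = p * (c *: q).
Proof.
apply/malgP=> k; rewrite mcoeffZ (mcoeffMl p q).
rewrite (@mcoeffMlw _ _ _ _ p (c *: q) k (fsubset_refl _) (msuppZ_le c q)) mulr_sumr.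
apply: eq_bigr => i _; rewrite mulr_sumr; apply: eq_bigr => j _.
by rewrite mcoeffZ mulrnAr mulrCA.
Qed.

Section FreeAlgebra.
Variables (F : fieldType) (X : choiceType).

Definition free_algebra : Type := {malg F[fmonom X]}.

HB.instance Definition _ := GRing.Lalgebra.on free_algebra.

Fact free_algebra_scaleAr (c : F) (p q : free_algebra) :
  c *: (p * q) = p * (c *: q).
Proof.
exact: (@malg_scaleAr F (fmonom X)).
Qed.

HB.instance Definition _ :=
  GRing.Lalgebra_isAlgebra.Build F free_algebra free_algebra_scaleAr.

Definition free_var (x : X) : free_algebra := << fmu x >>.

End FreeAlgebra.

Section EnvelopingAlgebra.
Variables (F : fieldType) (L : lieAlgType F).
Local Notation T := (free_algebra F L).
Implicit Types (p q : T) (x y : L).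

(* The two-sided ideal whose generators make [free_var] linear and turn the    *)
(* bracket into a commutator; the quotient by the linearity relations alone    *)
(* is the tensor algebra of L.                                                *)
Inductive env_ideal : T -> Prop :=
| env_ideal_linear (c : F) x y :
    env_ideal (free_var F (c *: x + y) - (c *: free_var F x + free_var F y))
| env_ideal_lie x y :
    env_ideal (free_var F x * free_var F y - free_var F y * free_var F x
               - free_var F (lie x y))
| env_ideal0 : env_ideal 0
| env_idealB p q : env_ideal p -> env_ideal q -> env_ideal (p - q)
| env_idealM p q r : env_ideal q -> env_ideal (p * q * r).

Lemma env_idealN p : env_ideal p -> env_ideal (- p).
Proof. by move=> hp; rewrite -sub0r; apply: env_idealB => //; exact: env_ideal0. Qed.

Lemma env_idealD p q : env_ideal p -> env_ideal q -> env_ideal (p + q).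
Proof. by move=> hp hq; rewrite -[q]opprK; apply/env_idealB/env_idealN. Qed.

Lemma env_idealMl p q : env_ideal q -> env_ideal (p * q).
Proof. by move=> hq; rewrite -[p * q]mulr1; apply: env_idealM. Qed.

Lemma env_idealMr p q : env_ideal p -> env_ideal (p * q).
Proof. by move=> hp; rewrite -[p]mul1r; apply: env_idealM. Qed.

Lemma env_idealZ (c : F) p : env_ideal p -> env_ideal (c *: p).
Proof. by move=> hp; rewrite -mulr_algl; apply: env_idealMl. Qed.

Definition env_rel p q : bool := `[< env_ideal (p - q) >].

Fact env_rel_refl : reflexive env_rel.
Proof. by move=> p; apply/asboolP; rewrite subrr; exact: env_ideal0. Qed.

Fact env_rel_sym : symmetric env_rel.
Proof.
by move=> p q; apply/asboolP/asboolP => /env_idealN; rewrite opprB.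
Qed.

Fact env_rel_trans : transitive env_rel.
Proof.
move=> q p r /asboolP pq /asboolP qr; apply/asboolP.
by rewrite -(subrKA q); apply: env_idealD.
Qed.

Canonical env_equiv := EquivRel env_rel env_rel_refl env_rel_sym env_rel_trans.

Definition enveloping : Type := {eq_quot env_rel}.
Local Notation U := enveloping.

HB.instance Definition _ := Choice.on U.
HB.instance Definition _ := EqQuotient.on U.

Lemma env_piP p q : \pi_U p = \pi_U q <-> env_ideal (p - q).
Proof. by split=> [/eqmodP/asboolP|h]; [|apply/eqmodP/asboolP]. Qed.

Lemma env_piW (u : U) : exists p, u = \pi_U p.
Proof. by exists (repr u); rewrite reprK. Qed.

Lemma env_reprP p : env_ideal (repr (\pi_U p) - p).
Proof. by apply/env_piP; rewrite reprK. Qed.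

Definition env_add (u v : U) : U := \pi_U (repr u + repr v).
Definition env_opp (u : U) : U := \pi_U (- repr u).
Definition env_mul (u v : U) : U := \pi_U (repr u * repr v).
Definition env_scale (c : F) (u : U) : U := \pi_U (c *: repr u).

Fact env_piD p q : \pi_U (p + q) = env_add (\pi_U p) (\pi_U q).
Proof.
apply/esym/env_piP; rewrite opprD addrACA.
by apply: env_idealD; apply: env_reprP.
Qed.

Fact env_piN p : \pi_U (- p) = env_opp (\pi_U p).
Proof. by apply/esym/env_piP; rewrite -opprD; apply/env_idealN/env_reprP. Qed.

Fact env_piM p q : \pi_U (p * q) = env_mul (\pi_U p) (\pi_U q).
Proof.
apply/esym/env_piP; set p' := repr _; set q' := repr _.
have -> : p' * q' - p * q = (p' - p) * q' + p * (q' - q).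
  by rewrite mulrBl mulrBr subrKA.
apply: env_idealD; first by apply: env_idealMr; apply: env_reprP.
by apply: env_idealMl; apply: env_reprP.
Qed.

Fact env_piZ c p : \pi_U (c *: p) = env_scale c (\pi_U p).
Proof. by apply/esym/env_piP; rewrite -scalerBr; apply/env_idealZ/env_reprP. Qed.

Fact env_addA : associative env_add.
Proof.
by move=> u v w; have [p ->] := env_piW u; have [q ->] := env_piW v; have [r ->] := env_piW w; rewrite -!env_piD addrA.
Qed.

Fact env_addC : commutative env_add.
Proof. by move=> u v; have [p ->] := env_piW u; have [q ->] := env_piW v; rewrite -!env_piD addrC. Qed.

Fact env_add0 : left_id (\pi_U 0) env_add.
Proof. by move=> u; have [p ->] := env_piW u; rewrite -env_piD add0r. Qed.

Fact env_addN : left_inverse (\pi_U 0) env_opp env_add.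
Proof. by move=> u; have [p ->] := env_piW u; rewrite -env_piN -env_piD addNr. Qed.

HB.instance Definition _ :=
  GRing.isZmodule.Build U env_addA env_addC env_add0 env_addN.

Fact env_mulA : associative env_mul.
Proof.
by move=> u v w; have [p ->] := env_piW u; have [q ->] := env_piW v; have [r ->] := env_piW w; rewrite -!env_piM mulrA.
Qed.

Fact env_mul1r : left_id (\pi_U 1) env_mul.
Proof. by move=> u; have [p ->] := env_piW u; rewrite -env_piM mul1r. Qed.

Fact env_mulr1 : right_id (\pi_U 1) env_mul.
Proof. by move=> u; have [p ->] := env_piW u; rewrite -env_piM mulr1. Qed.

Fact env_mulDl : left_distributive env_mul env_add.
Proof.
move=> u v w; have [p ->] := env_piW u; have [q ->] := env_piW v; have [r ->] := env_piW w.
by rewrite -!(env_piM, env_piD) mulrDl.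
Qed.

Fact env_mulDr : right_distributive env_mul env_add.
Proof.
move=> u v w; have [p ->] := env_piW u; have [q ->] := env_piW v; have [r ->] := env_piW w.
by rewrite -!(env_piM, env_piD) mulrDr.
Qed.

Lemma env_ideal_augmentation p : env_ideal p -> mcoeff (mone : fmonom L) p = 0.
Proof.
pose e (p : T) := mcoeff (mone : fmonom L) p.
have eM (q r : T) : e (q * r) = e q * e r by exact: (rmorphM (@mcoeff (fmonom L) F mone)).
have eB (q r : T) : e (q - r) = e q - e r.
  by exact: (raddfB (@mcoeff (fmonom L) F mone)).
have eP (c : F) (q r : T) : e (c *: q + r) = c * e q + e r.
  by exact: (linearP (@mcoeff (fmonom L) F mone)).
have eV x : e (free_var F x) = 0 by rewrite /e mcoeffU fm1_eq1.
have e0 : e 0 = 0 by rewrite /e mcoeff0.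
rewrite -/(e p); clearbody e; elim=> [c x y|x y||q r _ hq _ hr|q r s _ hr].
- by rewrite (eB (free_var F _)) eP !eV mulr0 addr0 subrr.
- have -> (a b c : T) : e (a * b - b * a - c) = e a * e b - e b * e a - e c.
    by rewrite [LHS]eB; congr (_ - _); rewrite [LHS]eB; congr (_ - _); apply: eM.
  by rewrite !eV mulr0 !subr0.
- exact: e0.
- by rewrite eB hq hr subrr.
- by rewrite 2!eM hr mulr0 mul0r.
Qed.

Fact env_oner_neq0 : (\pi_U 1 : U) != 0.
Proof.
apply/eqP => /env_piP /env_ideal_augmentation; rewrite subr0 mcoeff1 eqxx.
by move/eqP; rewrite oner_eq0.
Qed.

HB.instance Definition _ := GRing.Zmodule_isNzRing.Build U
  env_mulA env_mul1r env_mulr1 env_mulDl env_mulDr env_oner_neq0.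

Fact env_scaleA a b u : env_scale a (env_scale b u) = env_scale (a * b) u.
Proof. by have [p ->] := env_piW u; rewrite -!env_piZ scalerA. Qed.

Fact env_scale1 : left_id 1 env_scale.
Proof. by move=> u; have [p ->] := env_piW u; rewrite -env_piZ scale1r. Qed.

Fact env_scaleDr : right_distributive env_scale +%R.
Proof.
move=> c; move=> u v; have [p ->] := env_piW u; have [q ->] := env_piW v.
by rewrite -![_ + _]env_piD -!env_piZ -[RHS]env_piD scalerDr.
Qed.

Fact env_scaleDl u : {morph env_scale^~ u : a b / a + b}.
Proof.
by have [p ->] := env_piW u => a b; rewrite -!env_piZ -[RHS]env_piD scalerDl.
Qed.

HB.instance Definition _ := GRing.Zmodule_isLmodule.Build F U
  env_scaleA env_scale1 env_scaleDr env_scaleDl.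

Definition env_pi (p : T) : U := \pi_U p.

Fact env_pi_is_linear : linear env_pi.
Proof. by move=> c p q; rewrite /env_pi env_piD env_piZ. Qed.

Fact env_pi_is_monoid_morphism : monoid_morphism env_pi.
Proof. by split; [exact: erefl|move=> p q; exact: env_piM]. Qed.

HB.instance Definition _ :=
  GRing.isLinear.Build F T U *:%R env_pi env_pi_is_linear.
HB.instance Definition _ :=
  GRing.isMonoidMorphism.Build T U env_pi env_pi_is_monoid_morphism.

Fact env_scaleAl (c : F) (u v : U) : c *: (u * v) = c *: u * v.
Proof.
have [p ->] := env_piW u; have [q ->] := env_piW v.
by rewrite -!/(env_pi _) -linearZ -!rmorphM /= -linearZ scalerAl.
Qed.

HB.instance Definition _ := GRing.Lmodule_isLalgebra.Build F U env_scaleAl.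

Fact env_scaleAr (c : F) (u v : U) : c *: (u * v) = u * (c *: v).
Proof.
have [p ->] := env_piW u; have [q ->] := env_piW v.
by rewrite -!/(env_pi _) -linearZ -!rmorphM /= -linearZ scalerAr.
Qed.

HB.instance Definition _ := GRing.Lalgebra_isAlgebra.Build F U env_scaleAr.

Lemma env_pi_eq0 p : env_pi p = 0 <-> env_ideal p.
Proof. by rewrite -[p in env_ideal p]subr0; exact: env_piP. Qed.

Definition env_inj (x : L) : U := env_pi (free_var F x).

Fact env_inj_is_linear : linear env_inj.
Proof.
move=> c x y; apply/eqP; rewrite -subr_eq0 /env_inj -linearP -linearB.
by apply/eqP/env_pi_eq0; exact: env_ideal_linear.
Qed.

HB.instance Definition _ :=
  GRing.isLinear.Build F L U *:%R env_inj env_inj_is_linear.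

Lemma env_inj_lie x y :
  env_inj (lie x y) = env_inj x * env_inj y - env_inj y * env_inj x.
Proof.
apply/eqP; rewrite eq_sym -subr_eq0 /env_inj -!rmorphM -!linearB.
by apply/eqP/env_pi_eq0; exact: env_ideal_lie.
Qed.

End EnvelopingAlgebra.

Definition lie_action (F : fieldType) (L : lieAlgType F) (V : lmodType F)
    (rho : L -> V -> V) : Prop :=
  [/\ forall v, linear (rho^~ v), forall x, linear (rho x)
    & forall x y v, rho (lie x y) v = rho x (rho y v) - rho y (rho x v)].

Section EnvelopingModule.
Variables (F : fieldType) (L : lieAlgType F) (V : lmodType F).
Variables (rho : L -> V -> V) (rhoP : lie_action rho).
Local Notation T := (free_algebra F L).
Local Notation U := (enveloping L).

Definition word_act (w : fmonom L) (v : V) : V := foldr rho v w.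

Definition free_act (p : T) (v : V) : V := linext (word_act^~ v) p.

Fact word_act_linear w : linear (word_act w).
Proof.
case: rhoP => _ rl _ c u v; rewrite /word_act.
by elim: (w : seq L) => //= x s ->; rewrite rl.
Qed.

Fact free_act_linearl v : linear (free_act^~ v).
Proof. exact: (linearP (linext (word_act^~ v))). Qed.

Fact free_act_linear p : linear (free_act p).
Proof.
move=> c u v; rewrite /free_act /linext scaler_sumr -big_split.
apply: eq_bigr => w _ /=.
by rewrite word_act_linear scalerDr !scalerA mulrC.
Qed.

HB.instance Definition _ p :=
  GRing.isLinear.Build F V V *:%R (free_act p) (free_act_linear p).

Fact free_act1 v : free_act 1 v = v.
Proof. by rewrite /free_act (linextU (word_act^~ v) mone) /word_act fm1. Qed.

Fact free_actM p q v : free_act (p * q) v = free_act p (free_act q v).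
Proof.
move: p; apply: malg_linind.
- by move=> c p p'; rewrite mulrDl -scalerAl free_act_linearl.
- exact: free_act_linearl.
move=> w; rewrite [RHS](linextU (word_act^~ _) w).
move: q; apply: malg_linind.
- by move=> c p p'; rewrite mulrDr -scalerAr free_act_linearl.
- by move=> c p p'; rewrite free_act_linearl word_act_linear.
move=> w'; rewrite /free_act (linextU (word_act^~ _) w').
have -> : (<< w >> : T) * << w' >> = << mmul w w' >>.
  by rewrite [LHS]fgmulUU mul1r.
by rewrite (linextU (word_act^~ _)) /word_act fmM foldr_cat.
Qed.

Fact free_actV x v : free_act (free_var F x) v = rho x v.
Proof. by rewrite /free_act (linextU (word_act^~ v)) /word_act fmU. Qed.

Fact free_act_ideal p v : env_ideal p -> free_act p v = 0.
Proof.
have aB q r u : free_act (q - r) u = free_act q u - free_act r u.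
  exact: (linearB (linext (word_act^~ u))).
have aP c q r u : free_act (c *: q + r) u = c *: free_act q u + free_act r u.
  exact: free_act_linearl.
case: (rhoP) => rl _ rlie hp; elim: hp v => [c x y|x y||q r _ hq _ hr|q r s _ hr] v.
- by rewrite (aB (free_var F _)) aP !free_actV rl subrr.
- have -> (a b c : T) : free_act (a * b - b * a - c) v =
      free_act a (free_act b v) - free_act b (free_act a v) - free_act c v.
    rewrite [LHS]aB; congr (_ - _).
    by rewrite [LHS]aB; congr (_ - _); apply: free_actM.
  by rewrite !free_actV rlie subrr.
- exact: (linear0 (linext (word_act^~ v))).
- by rewrite aB hq hr subrr.
- by rewrite (free_actM (q * r)) (free_actM q) hr linear0.
Qed.

(* V, seen as the U(L)-module that the Lie action rho extends to. *)
Definition enveloping_module of lie_action rho : Type := V.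
Local Notation W := (enveloping_module rhoP).

HB.instance Definition _ := GRing.Zmodule.on W.

Definition env_act (u : U) (v : W) : W := free_act (repr u) v.

Fact env_act_pi p v : env_act (env_pi p) v = free_act p v.
Proof.
apply/eqP; rewrite -subr_eq0 /env_act -(linearB (linext (word_act^~ v))) /=.
by apply/eqP/free_act_ideal/env_reprP.
Qed.

Fact env_actA a b v : env_act a (env_act b v) = env_act (a * b) v.
Proof.
have [p ->] := env_piW a; have [q ->] := env_piW b.
by rewrite -!/(env_pi _) -rmorphM !env_act_pi free_actM.
Qed.

Fact env_act1 : left_id 1 env_act.
Proof. by move=> v; rewrite -(rmorph1 (env_pi (L := L))) env_act_pi free_act1. Qed.

Fact env_actDr : right_distributive env_act +%R.
Proof. by move=> a u v; exact: (linearD (free_act (repr a))). Qed.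

Fact env_actDl v : {morph env_act^~ v : a b / a + b}.
Proof.
move=> a b; have [p ->] := env_piW a; have [q ->] := env_piW b.
rewrite -!/(env_pi _) -linearD !env_act_pi.
exact: (linearD (linext (word_act^~ v))).
Qed.

HB.instance Definition _ := GRing.Zmodule_isLmodule.Build U W
  env_actA env_act1 env_actDr env_actDl.

Lemma env_pi_scale p (v : W) : env_pi p *: v = free_act p v.
Proof. exact: env_act_pi. Qed.

Lemma env_injZ (x : L) (v : W) : env_inj x *: v = rho x v.
Proof. by rewrite env_pi_scale free_actV. Qed.

End EnvelopingModule.

Section UniversalProperty.
Variables (F : fieldType) (L : lieAlgType F) (A : algType F).
Variables (f : {linear L -> A}).
Hypothesis f_lie : forall x y, f (lie x y) = f x * f y - f y * f x.
Local Notation U := (enveloping L).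

Fact env_lift_action : @lie_action F L A (fun x a => f x * a).
Proof.
split=> [a c x y|x c a b|x y a]; first by rewrite linearP mulrDl scalerAl.
  by rewrite mulrDr scalerAr.
by rewrite f_lie mulrBl !mulrA.
Qed.

Definition env_lift (u : U) : A := u *: (1 : enveloping_module env_lift_action).

Fact env_liftZ (u : U) (a : A) :
  u *: (a : enveloping_module env_lift_action) = env_lift u * a.
Proof.
have [p ->] := env_piW u; rewrite -!/(env_pi _).
rewrite /env_lift !env_pi_scale.
move: p; apply: malg_linind.
- exact: free_act_linearl.
- by move=> c p p'; rewrite free_act_linearl mulrDl scalerAl.
move=> w; rewrite /free_act !linextU /word_act.
by elim: (w : seq L) => [|x s /= ->]; rewrite /= ?mul1r ?mulrA.
Qed.

Fact env_lift_is_linear : linear env_lift.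
Proof.
move=> c u v; rewrite /env_lift scalerDl; congr (_ + _).
have [p ->] := env_piW u; rewrite -!/(env_pi _) -linearZ.
rewrite !env_pi_scale.
exact: (linearZ_LR (linext ((word_act (fun x a => f x * a))^~ 1)) c p).
Qed.

Fact env_lift_is_monoid_morphism : monoid_morphism env_lift.
Proof.
split; first by rewrite /env_lift scale1r.
by move=> u v; rewrite /env_lift -scalerA env_liftZ.
Qed.

HB.instance Definition _ :=
  GRing.isLinear.Build F U A *:%R env_lift env_lift_is_linear.
HB.instance Definition _ :=
  GRing.isMonoidMorphism.Build U A env_lift env_lift_is_monoid_morphism.

Lemma env_lift_inj x : env_lift (env_inj x) = f x.
Proof. by rewrite /env_lift env_injZ mulr1. Qed.

End UniversalProperty.

Lemma env_lift_unique (F : fieldType) (L : lieAlgType F) (A : algType F)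
    (g h : {lrmorphism enveloping L -> A}) :
  (forall x, g (env_inj x) = h (env_inj x)) -> g =1 h.
Proof.
move=> gh u; have [p ->] := env_piW u; rewrite -!/(env_pi _).
move: p; apply: malg_linind => [c p q|c p q|w]; try by rewrite !linearP.
case: w => s; elim: s => [|x s IH].
  have -> : << FMonom [::] >> = 1 :> free_algebra F L.
    by rewrite -[FMonom _]fmoneE.
  by rewrite !rmorph1.
have -> : << FMonom (x :: s) >> = free_var F x * << FMonom s >>.
  by rewrite [RHS]fgmulUU mul1r; congr << _ >>; apply/val_inj; rewrite /= fmM fmU.
by rewrite !rmorphM; congr (_ * _); [exact: gh|exact: IH].
Qed.

Section EnvelopingMap.
Variables (F : fieldType) (L L' : lieAlgType F) (f : {linear L -> L'}).
Hypothesis f_lie : lie_morphism f.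

Definition env_comp (x : L) : enveloping L' := env_inj (f x).

Fact env_comp_is_linear : linear env_comp.
Proof. by move=> c x y; rewrite /env_comp !linearP. Qed.

HB.instance Definition _ :=
  GRing.isLinear.Build F L (enveloping L') *:%R env_comp env_comp_is_linear.

Fact env_comp_lie x y :
  env_comp (lie x y) = env_comp x * env_comp y - env_comp y * env_comp x.
Proof. by rewrite /env_comp f_lie env_inj_lie. Qed.

Definition env_map : {lrmorphism enveloping L -> enveloping L'} :=
  env_lift env_comp_lie.

End EnvelopingMap.

Section BilinearOperation.
Variables (F : fieldType) (V : lmodType F) (br : V -> V -> V).
Hypotheses (brl : forall v, linear (br^~ v)) (brr : forall u, linear (br u)).

Lemma bilin0r u : br u 0 = 0.
Proof. by have := brr u (-1) 0 0; rewrite scaler0 addr0 scaleN1r addNr. Qed.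

Lemma bilinZr u c v : br u (c *: v) = c *: br u v.
Proof. by rewrite -[c *: v]addr0 brr bilin0r addr0. Qed.

Lemma bilinNr u v : br u (- v) = - br u v.
Proof. by rewrite -scaleN1r bilinZr scaleN1r. Qed.

Lemma bilin_alt_step c e w : (forall u v, br u v = - br v u) ->
  br e e = 0 -> br w w = 0 -> br (c *: e + w) (c *: e + w) = 0.
Proof.
move=> anti ee ww; rewrite brl !brr ee ww.
by rewrite scaler0 add0r addr0 (anti w) scalerN subrr.
Qed.

Definition jacobiator u v w := br u (br v w) + br v (br w u) + br w (br u v).

Lemma jacobiator_rot u v w : jacobiator u v w = jacobiator v w u.
Proof. by rewrite /jacobiator -addrA addrC. Qed.

Lemma jacobiator_linear v w : linear (fun u => jacobiator u v w).
Proof.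
move=> c x y; rewrite /jacobiator (brl (br v w)) (brr w c x y) (brr v).
rewrite (brl v c x y) (brr w) !scalerDr.
by rewrite (addrACA (c *: br x (br v w))) [LHS]addrACA.
Qed.

End BilinearOperation.

Section BilinearBracket.
Variables (F : fieldType) (K : choiceType) (b : K -> K -> {malg F[K]}).
Local Notation V := {malg F[K]}.

(* The bilinear extension of a bracket given on the basis << k >>. *)
Definition bilext (u v : V) : V := linext (fun p => linext (b p) v) u.

Fact bilext_linearl v : linear (bilext^~ v).
Proof. exact: linearP. Qed.

Fact bilext_linearr u : linear (bilext u).
Proof.
move=> c v w; rewrite /bilext /linext scaler_sumr -big_split.
apply: eq_bigr => p _ /=; rewrite -/(linext _ _) linearP scalerDr !scalerA.
by rewrite mulrC.
Qed.

Lemma bilextU p q : bilext << p >> << q >> = b p q.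
Proof. by rewrite /bilext !linextU. Qed.

Lemma bilext_anti : (forall p q, b p q = - b q p) ->
  forall u v, bilext u v = - bilext v u.
Proof.
move=> anti u v; move: u; apply: malg_linind.
- exact: bilext_linearl.
- by move=> c x y; rewrite bilext_linearr opprD scalerN.
move=> p; move: v; apply: malg_linind.
- exact: bilext_linearr.
- by move=> c x y; rewrite bilext_linearl opprD scalerN.
by move=> q; rewrite !bilextU.
Qed.

Lemma bilext_alt : (forall p q, b p q = - b q p) -> (forall p, b p p = 0) ->
  forall u, bilext u u = 0.
Proof.
move=> anti alt u.
rewrite [u]monalgE; elim/big_rec: _ => [|p y _ IH].
  exact: (linear0 (linext _)).
rewrite malgZU; apply: bilin_alt_step => //.
- exact: bilext_linearl.
- exact: bilext_linearr.
- exact: bilext_anti.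
- by rewrite bilextU.
Qed.

Lemma bilext_jacobi :
  (forall p q r, jacobiator bilext << p >> << q >> << r >> = 0) ->
  forall u v w, jacobiator bilext u v w = 0.
Proof.
move=> J0 u v w; have bl := bilext_linearl; have br := bilext_linearr.
have lin0 : linear (fun _ : V => 0 : V) by move=> c x y; rewrite scaler0 addr0.
have Jlin x y := jacobiator_linear bl br x y.
move: u; apply: malg_linind => // p; rewrite jacobiator_rot.
move: v; apply: malg_linind => // q; rewrite jacobiator_rot.
move: w; exact: malg_linind.
Qed.

End BilinearBracket.

Section LieSubalgebra.
Variables (F : fieldType) (L : lieAlgType F) (S : submodClosed L).
Hypothesis S_lie : {in S &, forall u v, lie u v \in S}.

Definition lie_subalgebra of {in S &, forall u v, lie u v \in S} : Type :=
  {u : L | u \in S}.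
Local Notation LS := (lie_subalgebra S_lie).

HB.instance Definition _ := [isSub of LS for sval].
HB.instance Definition _ := [Choice of LS by <:].
HB.instance Definition _ := [SubChoice_isSubLmodule of LS by <:].

Definition sublie (u v : LS) : LS :=
  Sub (lie (val u) (val v)) (S_lie (valP u) (valP v)).

Fact sublie_val u v : val (sublie u v) = lie (val u) (val v).
Proof. exact: SubK. Qed.

Local Notation vL := (val : {linear LS -> L}).

Fact sublie_linearl v : linear (sublie^~ v).
Proof.
move=> c x y; apply: val_inj.
by rewrite [RHS](linearP vL) !sublie_val (linearP vL) lie_linearl.
Qed.

Fact sublie_linearr u : linear (sublie u).
Proof.
move=> c x y; apply: val_inj.
by rewrite [RHS](linearP vL) !sublie_val (linearP vL) lie_linearr.
Qed.

Fact subliexx u : sublie u u = 0.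
Proof. by apply: val_inj; rewrite sublie_val liexx (linear0 vL). Qed.

Fact sublie_jacobi u v w :
  sublie u (sublie v w) + sublie v (sublie w u) + sublie w (sublie u v) = 0.
Proof.
have vD (a b : LS) : val (a + b) = val a + val b := linearD vL a b.
by apply: val_inj; rewrite !vD !sublie_val lie_jacobi (linear0 vL).
Qed.

HB.instance Definition _ := Lmodule_isLieAlgebra.Build F LS
  sublie_linearl sublie_linearr subliexx sublie_jacobi.

End LieSubalgebra.

Section Span2.
Variables (F : fieldType) (V : lmodType F) (x y : V).

Definition span2 : {pred V} :=
  fun u => `[< exists c d : F, u = c *: x + d *: y >].

Fact span2_submod_closed : GRing.submod_closed span2.
Proof.
split; first by apply/asboolP; exists 0, 0; rewrite !scale0r addr0.
move=> k u v /asboolP[c [d ->]] /asboolP[c' [d' ->]]; apply/asboolP.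
exists (k * c + c'), (k * d + d').
by rewrite scalerDr !scalerA !scalerDl addrACA.
Qed.

HB.instance Definition _ :=
  GRing.isSubmodClosed.Build F V span2 span2_submod_closed.

End Span2.

Fact span2_lie_closed (F : fieldType) (L : lieAlgType F) (x y : L) :
  lie x y = 0 -> {in span2 x y &, forall u v, lie u v \in span2 x y}.
Proof.
move=> xy _ _ /asboolP[c [d ->]] /asboolP[c' [d' ->]].
have lZ (u : L) k v : lie u (k *: v) = k *: lie u v by apply/bilinZr/lie_linearr.
have lD (u v w : L) : lie u (v + w) = lie u v + lie u w.
  by rewrite -[v]scale1r lie_linearr !scale1r.
have lZl (u : L) k v : lie (k *: u) v = k *: lie u v.
  exact: (@bilinZr F L (fun a b => lie b a) (@lie_linearl F L) v k u).
have lDl (u v w : L) : lie (u + v) w = lie u w + lie v w.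
  by rewrite -[u]scale1r lie_linearl !scale1r.
have yx : lie y x = 0.
  by have := liexx (x + y); rewrite lDl !lD !liexx xy !add0r addr0.
have -> : lie (c *: x + d *: y) (c' *: x + d' *: y) = 0.
  by rewrite lDl !lD !lZ !lZl !liexx xy yx !scaler0 !addr0.
exact: rpred0.
Qed.

(* LL stands for the Witt generators L_n. *)
Inductive WH4_letter := LL | La | Lb | Lc | Ld.

Definition nat_of_letter x : nat :=
  match x with LL => 0 | La => 1 | Lb => 2 | Lc => 3 | Ld => 4 end.
Definition letter_of_nat n :=
  match n with 0 => LL | 1 => La | 2 => Lb | 3 => Lc | _ => Ld end%N.
Fact nat_of_letterK : cancel nat_of_letter letter_of_nat. Proof. by case. Qed.
HB.instance Definition _ := Countable.copy WH4_letter (can_type nat_of_letterK).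

Definition WH4_coef (F : fieldType) x y (m n : int) : F :=
  match x, y with
  | LL, LL => (n - m)%:~R
  | LL, _ => n%:~R
  | _, LL => - m%:~R
  | La, Lb | Ld, La | Lb, Ld => 1
  | Lb, La | La, Ld | Ld, Lb => - 1
  | _, _ => 0
  end.

Definition WH4_target x y : WH4_letter :=
  match x, y with
  | LL, z | z, LL => z
  | La, Lb | Lb, La => Lc
  | z, Ld | Ld, z => z
  | _, _ => LL
  end.

Lemma WH4_jacobi_abstract (F : fieldType) (V : lmodType F)
    (br : V -> V -> V) (e : WH4_letter -> int -> V) :
  (forall u, linear (br u)) ->
  (forall x y m n,
    br (e x m) (e y n) = WH4_coef F x y m n *: e (WH4_target x y) (m + n)) ->
  forall x y z m n k, jacobiator br (e x m) (e y n) (e z k) = 0.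
Proof.
move=> brr brE x y z m n k; rewrite /jacobiator.
have brZ c u v : br u (c *: v) = c *: br u v by apply: bilinZr.
rewrite !brE !brZ !brE !scalerA.
have -> : n + (k + m) = m + (n + k) by ring.
have -> : k + (m + n) = m + (n + k) by ring.
case: x; case: y; case: z => /=;
  rewrite ?(mul0r, mulr0, scale0r, add0r, addr0) // -?scalerDl;
  rewrite [X in X *: _](_ : _ = 0) ?scale0r //;
  rewrite ?(rmorphD, rmorphN, rmorphB) /=; ring.
Qed.

Section WH4.
Variable F : fieldType.

(* W |x H_4^, with basis << (x, n) >> standing for x_n. *)
Definition WH4 : Type := {malg F[(WH4_letter * int)%type]}.

HB.instance Definition _ := GRing.Lmodule.on WH4.

Definition WH4_basis (x : WH4_letter) (n : int) : WH4 := << (x, n) >>.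
Local Notation "x '_[' n ]" := (WH4_basis x n) (at level 3, format "x '_[' n ]").

Definition WH4_bracket (p q : WH4_letter * int) : WH4 :=
  let: (x, m) := p in let: (y, n) := q in
  match x, y with
  | LL, LL => (n - m)%:~R *: LL _[m + n]
  | LL, _  => n%:~R *: y _[m + n]
  | _, LL  => - (m%:~R *: x _[m + n])
  | La, Lb => Lc _[m + n]
  | Lb, La => - Lc _[m + n]
  | Ld, La => La _[m + n]
  | La, Ld => - La _[m + n]
  | Ld, Lb => - Lb _[m + n]
  | Lb, Ld => Lb _[m + n]
  | _, _   => 0
  end.

Definition WH4_lie : WH4 -> WH4 -> WH4 := bilext WH4_bracket.

Fact WH4_bracket_anti p q : WH4_bracket p q = - WH4_bracket q p.
Proof.
case: p q => x m [y n].
by case: x; case: y; rewrite /= ?opprK ?oppr0 ?[n + m]addrC // -scaleNr -rmorphN opprB.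
Qed.

Fact WH4_bracket_alt p : WH4_bracket p p = 0.
Proof. by case: p => x m; case: x; rewrite /= ?subrr ?scale0r. Qed.

Fact WH4_bracketE x y m n :
  WH4_bracket (x, m) (y, n) = WH4_coef F x y m n *: (WH4_target x y) _[m + n].
Proof.
by case: x; case: y; rewrite /= ?scaleNr ?scale1r ?scale0r.
Qed.

Fact WH4_jacobi u v w : jacobiator WH4_lie u v w = 0.
Proof.
apply: bilext_jacobi => -[x m] [y n] [z k].
apply: (@WH4_jacobi_abstract _ _ _ WH4_basis); first exact: bilext_linearr.
by move=> *; rewrite bilextU WH4_bracketE.
Qed.

HB.instance Definition _ := Lmodule_isLieAlgebra.Build F WH4
  (bilext_linearl WH4_bracket) (bilext_linearr WH4_bracket)
  (bilext_alt WH4_bracket_anti WH4_bracket_alt) WH4_jacobi.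

Lemma WH4_lie_basis x y m n :
  lie (x _[m]) (y _[n]) = WH4_bracket (x, m) (y, n).
Proof. exact: bilextU. Qed.

Fact WH4_B_comm : lie (LL _[0]) (La _[0]) = 0.
Proof. by rewrite WH4_lie_basis WH4_bracketE scale0r. Qed.

(* B = F L_0 + F a_0 *)
Definition WH4_B : Type := lie_subalgebra (span2_lie_closed WH4_B_comm).

HB.instance Definition _ := LieAlgebra.on WH4_B.

Definition WH4_B_incl : {linear WH4_B -> WH4} := val.

Fact WH4_B_incl_lie : lie_morphism WH4_B_incl.
Proof. by []. Qed.

End WH4.

Lemma WH4_action (F : fieldType) (V : lmodType F)
    (w : WH4_letter * int -> V -> V) :
  (forall p, linear (w p)) ->
  (forall x y m n v, w (x, m) (w (y, n) v) - w (y, n) (w (x, m) v) =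
     WH4_coef F x y m n *: w (WH4_target x y, m + n) v) ->
  @lie_action F (WH4 F) V (fun u v => linext (w^~ v) u).
Proof.
move=> wl wP; have rl v : linear (linext (w^~ v)) by exact: linearP.
have rr u : linear (fun v => linext (w^~ v) u).
  move=> c v v'; rewrite /linext scaler_sumr -big_split.
  by apply: eq_bigr => p _ /=; rewrite wl scalerDr !scalerA mulrC.
split=> // u1 u2 v.
move: u1; apply: malg_linind => [c a b|c a b|[x m]].
- by rewrite lie_linearl rl.
- rewrite !rl rr scalerBr opprD !addrA; congr (_ + _); exact: addrAC.
move: u2; apply: malg_linind => [c a b|c a b|[y n]].
- by rewrite lie_linearr rl.
- rewrite !rl rr scalerBr opprD !addrA; congr (_ + _); exact: addrAC.
have lw p u : linext (w^~ u) << p >> = w p u by exact: linextU.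
have -> : lie (<< (x, m) >> : WH4 F) << (y, n) >> =
    WH4_coef F x y m n *: (<< (WH4_target x y, m + n) >> : {malg F[_]}).
  exact: etrans (WH4_lie_basis F x y m n) (WH4_bracketE F x y m n).
apply: etrans (linearZ_LR (linext (w^~ v)) _ _) _.
apply: etrans (congr1 _ (lw _ _)) (etrans (esym (wP _ _ _ _ _)) _).
by congr (_ - _); exact: esym (etrans (lw _ _) (congr1 (w _) (lw _ _))).
Qed.

Section BivariatePolynomials.
Variable F : fieldType.

(* F[s, t], with s the inner and t the outer variable, as an F-module. *)
Definition poly2 : Type := {poly {poly F}}.

HB.instance Definition _ := GRing.ComNzRing.on poly2.

Definition poly2_scale (c : F) (f : poly2) : poly2 := c%:P%:P * f.

Fact poly2_scaleA a b f : poly2_scale a (poly2_scale b f) = poly2_scale (a * b) f.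
Proof. by rewrite /poly2_scale mulrA !polyCM. Qed.

Fact poly2_scale1 : left_id 1 poly2_scale.
Proof. by move=> f; rewrite /poly2_scale mul1r. Qed.

Fact poly2_scaleDr : right_distributive poly2_scale +%R.
Proof. by move=> c f g; rewrite /poly2_scale mulrDr. Qed.

Fact poly2_scaleDl f : {morph poly2_scale^~ f : a b / a + b}.
Proof. by move=> a b; rewrite /poly2_scale !polyCD mulrDl. Qed.

HB.instance Definition _ := GRing.Zmodule_isLmodule.Build F poly2
  poly2_scaleA poly2_scale1 poly2_scaleDr poly2_scaleDl.

Definition poly2_s : poly2 := 'X%:P.
Definition poly2_t : poly2 := 'X.

Definition poly2_of_t (g : {poly F}) : poly2 := map_poly polyC g.

(* f(s - n, t) *)
Definition poly2_shift (n : int) (f : poly2) : poly2 :=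
  map_poly (comp_poly ('X - n%:~R%:P)) f.

Definition poly2_dt (f : poly2) : poly2 := f^`().

End BivariatePolynomials.

Section OmegaRelations.
Variables (F : fieldType) (R : comNzRingType).
Variables (C : F -> R) (sh : int -> R -> R) (dt : R -> R).
Variables (alpha beta gamma lambda : F) (s t g g' : R).

Definition Omega_formula (p : WH4_letter * int) (f : R) : R :=
  let: (x, n) := p in
  let f' := sh n f in
  match x with
  | LL => C (lambda ^ n) * ((s + C (n%:~R * alpha)) * f')
  | Ld => C (lambda ^ n * beta^-1) * ((t * g + C gamma) * f')
          + C (lambda ^ n) * (t * dt f')
  | La => C (lambda ^ n) * (t * f')
  | Lb => C (lambda ^ n) * (g * f') + C (lambda ^ n * beta) * dt f'
  | Lc => C (- (lambda ^ n * beta)) * f'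
  end.

Hypotheses (beta_neq0 : beta != 0) (lambda_neq0 : lambda != 0).
Hypotheses (CD : {morph C : x y / x + y}) (CM : {morph C : x y / x * y}).
Hypotheses (CN : {morph C : x / - x}) (C1 : C 1 = 1) (C0 : C 0 = 0).
Hypotheses (shD : forall n, {morph sh n : f h / f + h}).
Hypotheses (shM : forall n, {morph sh n : f h / f * h}).
Hypotheses (shC : forall n c, sh n (C c) = C c).
Hypotheses (shs : forall n, sh n s = s - C n%:~R).
Hypotheses (sht : forall n, sh n t = t) (shg : forall n, sh n g = g).
Hypotheses (sh_sh : forall m n f, sh m (sh n f) = sh (m + n) f).
Hypotheses (dt_sh : forall n f, dt (sh n f) = sh n (dt f)).
Hypotheses (dtD : {morph dt : f h / f + h}).
Hypotheses (dtM : forall f h, dt (f * h) = dt f * h + f * dt h).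
Hypotheses (dtC : forall c, dt (C c) = 0) (dts : dt s = 0) (dtt : dt t = 1).
Hypotheses (dtg : dt g = g').

Lemma Omega_formula_bracket x y m n f :
  Omega_formula (x, m) (Omega_formula (y, n) f)
  - Omega_formula (y, n) (Omega_formula (x, m) f)
  = C (WH4_coef F x y m n) * Omega_formula (WH4_target x y, m + n) f.
Proof.
have Cl : C (lambda ^ (m + n)) = C (lambda ^ m) * C (lambda ^ n).
  by rewrite -CM expfzDr.
have bV : C beta^-1 * C beta = 1 by rewrite -CM mulVf.
have iD (a b : int) : C (a + b)%:~R = C a%:~R + C b%:~R by rewrite rmorphD CD.
have iN (a : int) : C (- a)%:~R = - C a%:~R by rewrite rmorphN CN.
have shN k h : sh k (- h) = - sh k h.
  by rewrite -mulN1r -C1 -CN shM shC CN C1 mulN1r.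
have dtN h : dt (- h) = - dt h.
  by rewrite -mulN1r -C1 -CN dtM dtC mul0r add0r CN C1 mulN1r.
have nm : n + m = m + n by rewrite addrC.
case: x; case: y; rewrite /=;
  rewrite !(shD, shM, shC, shN, sht, shs, shg, sh_sh);
  rewrite ?(dtD, dtM, dtC, dtN, dt_sh, dtt, dts, dtg) ?sh_sh ?nm;
  rewrite !(CM, CD, CN, C0, C1, iD, iN, Cl);
  ring: bV.
Qed.

End OmegaRelations.

Section Omega.
Variables (F : fieldType) (alpha beta gamma lambda : F) (g : {poly F}).
Local Notation s := (poly2_s F).
Local Notation t := (poly2_t F).
Local Notation gt := (poly2_of_t g).
Local Notation dt := (@poly2_dt F).

Definition Omega_basis (p : WH4_letter * int) (f : poly2 F) : poly2 F :=
  let: (x, n) := p in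
  let f' := poly2_shift n f in
  match x with
  | LL => lambda ^ n *: ((s + (n%:~R * alpha)%:P%:P) * f')
  | Ld => (lambda ^ n * beta^-1) *: ((t * gt + gamma%:P%:P) * f')
          + lambda ^ n *: (t * dt f')
  | La => lambda ^ n *: (t * f')
  | Lb => lambda ^ n *: (gt * f') + (lambda ^ n * beta) *: dt f'
  | Lc => - (lambda ^ n * beta) *: f'
  end.

Definition Omega_act (u : WH4 F) (f : poly2 F) : poly2 F :=
  linext (Omega_basis^~ f) u.

Hypotheses (beta_neq0 : beta != 0) (lambda_neq0 : lambda != 0).

Local Notation sh := (@poly2_shift F).
Local Notation C := (fun c : F => (c%:P%:P : poly2 F)).

Let scaleE c (f : poly2 F) : c *: f = C c * f. Proof. by []. Qed.

Let shD n : {morph sh n : f h / f + h}.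
Proof. exact: (rmorphD (map_poly (comp_poly ('X - n%:~R%:P)))). Qed.

Let shM n : {morph sh n : f h / f * h}.
Proof. exact: (rmorphM (map_poly (comp_poly ('X - n%:~R%:P)))). Qed.

Let shC n c : sh n (C c) = C c.
Proof. by rewrite /poly2_shift map_polyC /= comp_polyC. Qed.

Let sht n : sh n t = t.
Proof. exact: map_polyX. Qed.

Let shs n : sh n s = s - C n%:~R.
Proof. by rewrite /poly2_shift map_polyC /= comp_polyX polyCB. Qed.

Let shg n (h : {poly F}) : sh n (poly2_of_t h) = poly2_of_t h.
Proof.
apply/polyP=> i; rewrite coef_map /= !coef_map /=; exact: comp_polyC.
Qed.

Let sh_sh m n f : sh m (sh n f) = sh (m + n) f.
Proof.
apply/polyP=> i; rewrite !coef_map /= -comp_polyA; congr (_ \Po _).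
by rewrite comp_polyB comp_polyX comp_polyC rmorphD /= polyCD opprD addrA.
Qed.

Let dt_sh n f : dt (sh n f) = sh n (dt f).
Proof. exact: deriv_map. Qed.

Let dtD f h : dt (f + h) = dt f + dt h. Proof. exact: derivD. Qed.
Let dtM f h : dt (f * h) = dt f * h + f * dt h. Proof. exact: derivM. Qed.
Let dtC c : dt (C c) = 0. Proof. exact: derivC. Qed.
Let dts : dt s = 0. Proof. exact: derivC. Qed.
Let dtt : dt t = 1. Proof. exact: derivX. Qed.
Let dtg (h : {poly F}) : dt (poly2_of_t h) = poly2_of_t h^`().
Proof. exact: deriv_map. Qed.

Fact Omega_basis_linear p : linear (Omega_basis p).
Proof.
case: p => x n c f h; rewrite /Omega_basis !scaleE.
case: x; rewrite !(shD, shM, shC, dtD, dtM, dtC); ring.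
Qed.

Fact Omega_actP : lie_action Omega_act.
Proof.
apply: WH4_action; first exact: Omega_basis_linear.
move=> x y m n f.
apply: (@Omega_formula_bracket F (poly2 F) C sh dt alpha beta gamma lambda
  s t gt (poly2_of_t g^`())) => //.
all: by move=> *; rewrite ?(polyCD, polyCM, polyCN).
Qed.

Definition Omega : lmodType (enveloping (WH4 F)) :=
  enveloping_module Omega_actP.

End Omega.

Arguments Omega {F} alpha beta gamma lambda g beta_neq0 lambda_neq0.

Lemma Omega_basisZ (F : fieldType) (alpha beta gamma lambda : F) (g : {poly F})
    (beta_neq0 : beta != 0) (lambda_neq0 : lambda != 0)
    (x : WH4_letter) (n : int) (f : poly2 F) :
  env_inj (WH4_basis F x n)
    *: (f : Omega alpha beta gamma lambda g beta_neq0 lambda_neq0)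
  = Omega_basis alpha beta gamma lambda g (x, n) f.
Proof.
rewrite env_injZ /Omega_act.
exact: (linextU (Omega_basis alpha beta gamma lambda g ^~ f) (x, n)).
Qed.

(* Main.v *)
From HB Require Import structures.
Require Import Defs.
From mathcomp Require Import all_boot all_order all_algebra.
From mathcomp Require Import boolp reals complex.
From mathcomp.multinomials Require Import monalg.
From mathcomp Require Import ring zify.

Set Implicit Arguments.
Unset Strict Implicit.
Unset Printing Implicit Defensive.

Import GRing.Theory.
Local Open Scope ring_scope.

(* M is F[s, t] with L_0 = s and a_0 = t.  The relations with L_0 and a_0 make *)
(* x_n a shift f(s, t) |-> f(s - n, t) followed by multiplication by x_n 1,    *)
(* plus a t-derivative term for b_n and d_n.  Comparing leading coefficients   *)
(* in s in [L_m, L_n] = (n - m) L_(m+n) forces L_n 1 = lambda^n (s + n alpha), *)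
(* alpha in F[t], lambda a unit of F[t], hence constant; the same comparison in *)
(* [L_m, x_n] = n x_(m+n) gives x_n 1 = lambda^n h(t).  Simplicity enters only *)
(* through c_0, which is central: it acts as a unit of F[s, t] or as 0, and if *)
(* it is 0 then t M is a submodule.  Finally [L_1, b_0] = 0 forces alpha' = 0  *)
(* and [d_0, b_0] = - b_0 determines d_0 1 up to a constant.                   *)

(** * Leading coefficients in s, and the Witt algebra *)

(** Through [U(B) = F[s, t]], the module becomes [F[s, t]] with [L_0] and [a_0] acting as [s] and
    [t] ([free_of_rank1_polynomials]). Commutation with these two operators leaves only the
    polynomials [x_n 1] unknown ([shift_intertwiner]). The engine is a degree count in [s]: if [l]
    and [h] have degrees [k] and [j] and leading coefficients [a] and [b], then
    [l(s) h(s - m) - h(s) l(s - n)] has degree at most [k + j - 1], with coefficient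
    [(n k - m j) a b] there ([topcoef_bracket]). In characteristic zero a nonzero integer factor
    fixes the degree exactly. Hence [L_n 1] is linear in [s] ([witt_rank1]), and a family satisfying
    [[L_m, x_n] = n x_(m+n)] without derivative terms is free of [s] ([witt_density]). This applies
    at once to [a] and [c]; for [b] and [d] the t-derivative of [L_m 1] intervenes until [alpha] is
    known to be constant. [WH4_rank1_action] assembles the formulas, and
    [simple_rank1_isomorphic_Omega] carries them back to the module. *)

Lemma polyC_int (A : nzRingType) (n : int) : n%:~R%:P = n%:~R :> {poly A}.
Proof. exact: (rmorph_int polyC). Qed.

Section TopCoefficient.
Variable A : comNzRingType.
Implicit Types (f h l : {poly A}) (a b c : A) (j k : nat) (m n : int).

(** The coefficient [c] may be zero, so that differences and products need no case distinction on
    cancellation; only when [c != 0] is [k] the degree ([topcoef_size]). *)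
Definition topcoef k f c := (size f <= k.+1)%N /\ f`_k = c.

Lemma topcoef_neq0 f : f != 0 -> topcoef (size f).-1 f (lead_coef f).
Proof. by rewrite -size_poly_gt0 => f0; rewrite /topcoef prednK. Qed.

Lemma topcoef_size k f c : topcoef k f c -> c != 0 -> size f = k.+1.
Proof.
move=> [le <-] c0; apply/eqP; rewrite eqn_leq le ltnNge.
by apply: contraNN c0 => /leq_sizeP->.
Qed.

Lemma topcoefB k f h a b :
  topcoef k f a -> topcoef k h b -> topcoef k (f - h) (a - b).
Proof.
move=> [fk <-] [hk <-]; split; last by rewrite coefB.
by rewrite (leq_trans (size_polyD _ _)) // size_polyN geq_max fk.
Qed.

Lemma topcoefM j k f h a b :
  topcoef j f a -> topcoef k h b -> topcoef (j + k) (f * h) (a * b).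
Proof.
move=> [fj <-] [hk <-]; split.
  apply: leq_trans (size_polyMleq _ _) _.
  by rewrite -subn1 leq_subLR add1n -addnS -addSn leq_add.
have jk : (j < (j + k).+1)%N by rewrite ltnS leq_addr.
rewrite coefM (bigD1 (Ordinal jk)) //= addKn big1 ?addr0 // => i.
rewrite -val_eqE /= neq_ltn => /orP[ij|ji].
  by rewrite mulrC (leq_sizeP _ _ hk) ?mul0r //; lia.
by rewrite (leq_sizeP _ _ fj) ?mul0r.
Qed.

Definition poly_shift n f : {poly A} := f \Po ('X - n%:~R%:P).

(* The factor 'X compensates the drop in degree, so that no truncated         *)
(* subtraction is needed for j = 0.                                           *)
Lemma topcoef_shift n j h c : topcoef j h c ->
  topcoef j ('X * (poly_shift n h - h)) (- (n *~ j)%:~R * c).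
Proof.
elim/poly_ind: h j c => [|h d IH] j c.
  rewrite /poly_shift rmorph0 subrr mulr0 => -[_ <-].
  by split; rewrite ?size_poly0 // coef0 mulr0.
case: j => [|j] [sz <-].
  have -> : h = 0.
    move: sz; rewrite size_MXaddC; case: ifP => [/andP[/eqP->]//|_].
    by rewrite ltnS leqn0 size_poly_eq0 => /eqP.
  rewrite mul0r add0r /poly_shift comp_polyC subrr mulr0.
  by split; rewrite ?size_poly0 // coef0 mulr0z oppr0 mul0r.
have {}/IH top : topcoef j h h`_j.
  split=> //; move: sz; rewrite size_MXaddC; case: ifP => // /andP[/eqP-> _].
  by rewrite size_poly0.
have -> : 'X * (poly_shift n (h * 'X + d%:P) - (h * 'X + d%:P)) =
    ('X - n%:~R%:P) * ('X * (poly_shift n h - h)) - n%:~R%:P * 'X * h.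
  rewrite /poly_shift comp_polyD comp_polyM comp_polyX comp_polyC; ring.
rewrite coefD coefMX coefC addr0 /=.
have -> : - (n *~ j.+1)%:~R * h`_j =
    1 * (- (n *~ j)%:~R * h`_j) - n%:~R * 1 * h`_j :> A.
  have -> : n *~ j.+1 = n *~ j + n by lia.
  by rewrite rmorphD /=; ring.
rewrite -[j.+1]add1n; apply: topcoefB.
  apply: topcoefM top; split; first by rewrite size_XsubC.
  by rewrite coefB coefX coefC subr0.
apply: topcoefM; last first.
  split=> //; move: sz; rewrite size_MXaddC; case: ifP => // /andP[/eqP-> _].
  by rewrite size_poly0.
split; last by rewrite coefCM coefX.
apply: leq_trans (size_polyMleq _ _) _.
by rewrite size_polyX size_polyC; case: (_ != 0).
Qed.

(** Subtracting [l * h] from both products leaves [l] times the difference of [h] minus [h] times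
    the difference of [l], and each difference lowers the degree by one. *)
Lemma topcoef_bracket m n k j l h a b :
  topcoef k l a -> topcoef j h b ->
  topcoef (k + j) ('X * (l * poly_shift m h - h * poly_shift n l))
    ((n *~ k - m *~ j)%:~R * (a * b)).
Proof.
move=> tl th.
have -> : 'X * (l * poly_shift m h - h * poly_shift n l) =
    l * ('X * (poly_shift m h - h)) - h * ('X * (poly_shift n l - l)) by ring.
have -> : (n *~ k - m *~ j)%:~R * (a * b) =
   a * (- (m *~ j)%:~R * b) - b * (- (n *~ k)%:~R * a) :> A.
  by rewrite rmorphB /=; ring.
apply: topcoefB; first by apply: topcoefM => //; apply: topcoef_shift.
by rewrite addnC; apply: topcoefM => //; apply: topcoef_shift.
Qed.

End TopCoefficient.

(** * Witt actions on [A[s]]: the values [L_n 1] *)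

Section WittRankOne.
Variable A : idomainType.
Hypothesis intrA_eq0 : forall n : int, (n%:~R == 0 :> A) = (n == 0).
Variable l : int -> {poly A}.
Hypothesis l0 : l 0 = 'X.
Hypothesis lP : forall m n,
  l m * poly_shift m (l n) - l n * poly_shift n (l m) = (n - m)%:~R * l (m + n).

Local Notation deg n := (size (l n)).-1.

Let pintr_eq0 (n : int) : (n%:~R == 0 :> {poly A}) = (n == 0).
Proof. by rewrite -polyC_int polyC_eq0 intrA_eq0. Qed.

(** For [n != 0], the bracket of [L_(-n)] and [L_n] is [2n L_0], which sends 1 to [2n s], not to
    0. *)
Let l_neq0 (n : int) : l n != 0.
Proof.
have [->|n0] := eqVneq n 0; first by rewrite l0 polyX_eq0.
apply/eqP => ln0; have /eqP := lP (- n) n.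
rewrite ln0 /poly_shift rmorph0 mulr0 mul0r subrr addNr l0 eq_sym mulf_eq0 polyX_eq0.
by rewrite orbF pintr_eq0; lia.
Qed.

Let size_l (n : int) : size (l n) = (deg n).+1.
Proof. by rewrite prednK // size_poly_gt0. Qed.

Let deg_bracket (m n : int) : n *~ deg m - m *~ deg n != 0 -> m != n ->
  deg (m + n) = (deg m + deg n).-1 /\
  (n *~ deg m - m *~ deg n)%:~R * (lead_coef (l m) * lead_coef (l n)) =
  (n - m)%:~R * lead_coef (l (m + n)).
Proof.
move=> kn0 mn; have [tm tn] := (topcoef_neq0 (l_neq0 m), topcoef_neq0 (l_neq0 n)).
have := topcoef_bracket m n tm tn; rewrite lP => top.
have mn0 : n - m != 0 by rewrite subr_eq0 eq_sym.
have sz := topcoef_size top.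
rewrite !mulf_eq0 intrA_eq0 !lead_coef_eq0 !negb_or kn0 !l_neq0 in sz.
have {}sz := sz isT.
have sE : size ('X * ((n - m)%:~R * l (m + n))) = (deg (m + n)).+2.
  rewrite mulrCA -polyC_int size_Cmul ?intrA_eq0 // mulrC size_mulX //.
  by rewrite size_l.
rewrite sE in sz; split; first by case: sz => <-.
case: top => _ <-; case: sz => <-; rewrite coefXM /= -polyC_int coefCM.
by [].
Qed.

(** The bracket of [L_(-k)] and [L_k] forces the two degrees to add up to 2. Degree 0 for [L_k 1]
    would mean degree 2 for [L_(-k) 1], and the bracket of [L_(-k)] with [L_(2k)], whose factor
    [k (4 + deg (2k))] is nonzero, would give [L_k 1] degree [1 + deg (2k) > 0]. *)
Let deg1 (n : int) : n != 0 -> deg n = 1%N.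
Proof.
have deg_opp (k : int) : k != 0 -> (deg (- k) + deg k)%N = 2%N.
  move=> k0; case: (posnP (deg (- k) + deg k)) => [d0|d_gt0].
    have := topcoef_bracket (- k) k (topcoef_neq0 (l_neq0 (- k))) (topcoef_neq0 (l_neq0 k)).
    rewrite lP d0 addNr l0 => -[]; rewrite mulrCA -polyC_int size_Cmul ?intrA_eq0; last lia.
    by rewrite size_mulX ?polyX_eq0 // size_polyX.
  have [] := @deg_bracket (- k) k; [|lia|].
    by rewrite !mulrzz mulNr opprK -mulrDr mulf_neq0 //; lia.
  rewrite addNr l0 size_polyX; lia.
have deg0 (k : int) : k != 0 -> deg k != 0%N.
  move=> k0; apply/eqP=> dk; have := deg_opp k k0; rewrite dk addn0 => dk'.
  have [] := @deg_bracket (- k) (k + k); [|lia|].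
    have -> : (k + k) *~ deg (- k) - (- k) *~ deg (k + k) = k * (4 + (deg (k + k))%:Z).
      by rewrite !mulrzz dk'; ring.
    by rewrite mulf_neq0.
  by rewrite addKr dk dk'; lia.
move=> n0; have := deg_opp n n0; have := deg0 n n0.
have : deg (- n) != 0%N by apply: deg0; rewrite oppr_eq0.
by case: (deg (- n)) (deg n) => [|a] [|[|b]] //; rewrite !addnS.
Qed.

Let p n := (l n)`_1.
Let q n := (l n)`_0.

Let lE n : l n = (p n)%:P * 'X + (q n)%:P.
Proof.
apply/polyP=> i; rewrite coefD coefCM coefX coefC.
case: i => [|[|i]] /=; rewrite ?mulr1 ?mulr0 ?addr0 ?add0r //.
apply/leq_sizeP; last exact: leqnn.
rewrite size_l; have [->|/deg1->//] := eqVneq n 0.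
by rewrite l0 size_polyX.
Qed.

(** These are the coefficients of [s] and of 1 in the Witt relation. Both are void for [m = n], so
    index 2 has to be reached through negative indices below. *)
Let pqP (m n : int) : (n - m)%:~R * (p m * p n) = (n - m)%:~R * p (m + n) /\
  n%:~R * (p m * q n) - m%:~R * (p n * q m) = (n - m)%:~R * q (m + n).
Proof.
have := lP m n; rewrite !lE /poly_shift !(comp_polyD, comp_polyM, comp_polyX, comp_polyC).
set pm := p m; set pn := p n; set qm := q m; set qn := q n => E.
have {}E : ((n - m)%:~R * (pm * pn))%:P * 'X + (n%:~R * (pm * qn) - m%:~R * (pn * qm))%:P
   = ((n - m)%:~R * p (m + n))%:P * 'X + ((n - m)%:~R * q (m + n))%:P.
  move: E; rewrite -!polyC_int !(polyCM, polyCB, polyCD, rmorphB) /=.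
  pose r : {poly A} := (p (m + n))%:P * 'X + (q (m + n))%:P.
  move=> E; transitivity ((n%:~R%:P - m%:~R%:P) * r); last by rewrite /r; ring.
  by rewrite -E; ring.
have [E1 E0] := (congr1 (fun f : {poly A} => f`_1) E, congr1 (fun f : {poly A} => f`_0) E).
by split; [move: E1|move: E0];
  rewrite !(coefD, coefCM, coefX, coefC) /= ?mulr1 ?mulr0 ?addr0 ?add0r.
Qed.

Let intr_can (n : int) : n != 0 -> injective ( *%R (n%:~R : A)).
Proof. by move=> n0; apply: mulfI; rewrite intrA_eq0. Qed.

Let p0 : p 0 = 1. Proof. by rewrite /p l0 coefX. Qed.
Let q0 : q 0 = 0. Proof. by rewrite /q l0 coefX. Qed.

Let p_opp (n : int) : p n * p (- n) = 1.
Proof.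
have [->|n0] := eqVneq n 0; first by rewrite oppr0 p0 mulr1.
have [+ _] := pqP n (- n); rewrite subrr p0; apply: intr_can; lia.
Qed.

Let p_add (m n : int) : n != m -> p (m + n) = p m * p n.
Proof. by move=> nm; have [/intr_can->] := pqP m n => //; rewrite subr_eq0. Qed.

Let p_unit (n : int) : p n \is a GRing.unit.
Proof. by apply/unitrPr; exists (p (- n)); exact: p_opp. Qed.

Let p_exp (n : int) : p n = p 1 ^ n.
Proof.
have pS (k : int) : p (1 + k) = p 1 * p k.
  have [->|/p_add//] := eqVneq k 1.
  (* The case [p 2 = p 1 * p 1] escapes [p_add]; it follows from [p (- 1) * p 2 = p 1]. *)
  apply: (mulrI (p_unit (- 1))); rewrite mulrA [p (- 1) * p 1]mulrC p_opp mul1r.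
  by rewrite -p_add.
have pnat (k : nat) : p k = p 1 ^+ k.
  elim: k => [|k IH]; first by rewrite p0.
  by rewrite exprS -IH -pS; congr p; lia.
case: n => k; first exact: pnat.
apply: (mulrI (p_unit k.+1)); rewrite NegzE p_opp -invr_expz pnat.
by rewrite -exprnP divrr // unitrX.
Qed.

Let q_lin (n : int) : q n = n%:~R * (q 1 / p 1) * p n.
Proof.
have q_opp (k : int) : q (- k) = - (p (- k) ^+ 2 * q k).
  have [->|k0] := eqVneq k 0; first by rewrite oppr0 q0 mulr0 oppr0.
  have [_] := pqP (- k) k; rewrite addNr q0 mulr0 rmorphN /= mulNr opprK -mulrDr.
  move/eqP; rewrite mulf_eq0 intrA_eq0 (negbTE k0) addrC => /eqP /(congr1 ( *%R (p (- k)))).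
  rewrite mulrDr mulr0 [p (- k) * (p k * _)]mulrA [p (- k) * p k]mulrC p_opp mul1r.
  by move/eqP; rewrite addr_eq0 mulrA -expr2 => /eqP.
set al := q 1 / p 1; have q1 : q 1 = al * p 1 by rewrite /al divrK.
(* The induction below uses the bracket with [L_1], which says nothing about [q 2]; this value comes
   from [[L_(-1), L_2] = 3 L_1]. *)
have q2 : q 2 = 2%:~R * al * p 2.
  have [_] := pqP (- 1) 2; rewrite [q (_ + _)](_ : _ = q 1) // q_opp q1.
  have -> : p 2 = p 1 * p 1 by rewrite p_exp -exprnP expr2.
  move=> E; have {}E : 2%:~R * (p (-1) * q 2) = 2%:~R * (p (-1) * (2%:~R * al * (p 1 * p 1))).
    have pp := p_opp 1.
    transitivity (3%:~R * (al * p 1) + p 1 * p 1 * (p (-1) ^+ 2 * (al * p 1))).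
      have -> : 3%:~R = (2 - (-1))%:~R :> A by [].
      by rewrite -E rmorphN /=; ring.
    transitivity ((3%:~R + (p 1 * p (- 1)) ^+ 2) * (al * p 1)); first by ring.
    transitivity (4%:~R * (p 1 * p (- 1)) * (al * p 1)); last by ring.
    by rewrite pp; ring.
  exact: (mulrI (p_unit (- 1)) (intr_can _ E)).
have qnat (k : nat) : q k = k%:~R * al * p k.
  elim: k => [|k IH]; first by rewrite q0 !mul0r.
  case: k IH => [_|k IH]; first by rewrite q1 mul1r.
  case: k IH => [_|k IH]; first exact: q2.
  have [_] := pqP 1 k.+2; rewrite (_ : 1 + k.+2%:Z = k.+3%:Z) //.
  rewrite IH q1 => E; apply: (@intr_can k.+1) => //.
  have -> : k.+1%:Z = k.+2%:Z - 1 by rewrite -[k.+2]addn1 PoszD addrK.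
  rewrite -E (_ : k.+3%:Z = 1 + k.+2%:Z) // p_add //.
  by rewrite !rmorphD rmorphN /=; ring.
case: n => k; first exact: qnat.
rewrite NegzE q_opp qnat rmorphN /=; have := p_opp k.+1.
by move=> pp; ring: pp.
Qed.

Lemma witt_rank1 : exists lambda alpha : A, lambda \is a GRing.unit /\
  forall n : int, l n = (lambda ^ n)%:P * ('X + (n%:~R * alpha)%:P).
Proof.
exists (p 1), (q 1 / p 1); split; first exact: p_unit.
by move=> n; rewrite lE q_lin p_exp polyCM mulrDr [X in _ + X]mulrC.
Qed.

End WittRankOne.

(** * Families with [[L_m, x_n] = n x_(m+n)] *)

Section WittDensities.
Variables (A : idomainType) (lambda alpha : A).
Hypothesis intrA_eq0 : forall n : int, (n%:~R == 0 :> A) = (n == 0).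
Hypothesis lambda_unit : lambda \is a GRing.unit.
Local Notation l n := ((lambda ^ n)%:P * ('X + (n%:~R * alpha)%:P)).

Let lam_neq0 (n : int) : lambda ^ n != 0.
Proof.
by apply: contraTneq (unitrXz n lambda_unit) => ->; rewrite unitr0.
Qed.

Let top_l (n : int) : topcoef 1 (l n) (lambda ^ n).
Proof.
split; last by rewrite coefCM coefD coefX coefC addr0 mulr1.
by rewrite size_Cmul // size_XaddC.
Qed.

(** If [h] has positive degree [j] in [s], the factor is [- j], so its bracket with [L_1] has degree
    exactly [j] and cannot be the constant [c]. *)
Lemma witt_invariant_const (c h : {poly A}) : (size c <= 1)%N ->
  l 1 * poly_shift 1 h - h * l 1 = c -> h = (h`_0)%:P /\ c = 0.
Proof.
move=> sc E; have hC : h = (h`_0)%:P.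
  apply: size1_polyC; rewrite leqNgt; apply/negP=> sh.
  have h0 : h != 0 by apply: contraTneq sh => ->; rewrite size_poly0.
  have := topcoef_bracket 1 0 (top_l 1) (topcoef_neq0 h0).
  rewrite {2}/poly_shift subr0 comp_polyXr E => /topcoef_size.
  have nz : 0 *~ 1%N - 1 *~ (size h).-1 != 0 :> int.
    by rewrite !mulrzz mul0r sub0r mul1r oppr_eq0; case: (size h) sh => [|[|k]].
  rewrite !mulf_eq0 intrA_eq0 lead_coef_eq0 !negb_or nz h0 lam_neq0 => /(_ isT).
  have [->|c0] := eqVneq c 0; first by rewrite mulr0 size_poly0.
  rewrite mulrC size_mulX // => -[sz]; move: sc; rewrite sz.
  by case: (size h) sh => [|[|k]].
by split=> //; rewrite -E hC /poly_shift comp_polyC mulrC subrr.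
Qed.

(** [[L_1, x_0] = 0] makes [h 0] constant. Then [[L_(-n), x_n] = n x_0] is constant too, while the
    factor [n (1 + j)] is nonzero; this forces the degree [j] of [h n] to be 0, and the coefficient
    identity yields [h n]. *)
Lemma witt_density (h : int -> {poly A}) :
  (forall m n, l m * poly_shift m (h n) - h n * poly_shift n (l m) =
    n%:~R * h (m + n)) ->
  forall n, h n = (lambda ^ n * (h 0)`_0)%:P.
Proof.
move=> hP; have [h0 _] : h 0 = ((h 0)`_0)%:P /\ 0 = 0 :> {poly A}.
  apply: witt_invariant_const; first by rewrite size_poly0.
  have := hP 1 0; rewrite mul0r => <-; congr (_ - _ * _).
  by rewrite /poly_shift subr0 comp_polyXr.
move=> n; have [->|n0] := eqVneq n 0; first by rewrite mul1r.
have := hP (- n) n; set c := (h 0)`_0 in h0 *; rewrite addNr h0 => E.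
have {}E : l (- n) * poly_shift (- n) (h n) - h n * poly_shift n (l (- n)) = (n%:~R * c)%:P.
  by rewrite E polyCM polyC_int.
have [hn0|hn0] := eqVneq (h n) 0.
  move/eqP: E; rewrite hn0 /poly_shift rmorph0 mulr0 mul0r subrr eq_sym polyC_eq0.
  by rewrite mulf_eq0 intrA_eq0 (negbTE n0) => /eqP->; rewrite mulr0.
have := topcoef_bracket (- n) n (top_l (- n)) (topcoef_neq0 hn0); rewrite E.
set j := (size (h n)).-1 => top.
have nz : n *~ 1%N - (- n) *~ j != 0.
  rewrite (_ : _ - _ = n * (1 + j%:Z)); first by rewrite mulf_neq0.
  by rewrite !mulrzz; ring.
have sz := topcoef_size top.
rewrite !mulf_eq0 intrA_eq0 lead_coef_eq0 !negb_or nz hn0 lam_neq0 in sz.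
have j0 : j = 0%N.
  apply/eqP; rewrite -leqn0 -ltnS -ltnS -[j.+2]/((1 + j).+1) -(sz isT).
  apply: leq_trans (size_polyMleq _ _) _.
  by rewrite size_polyX size_polyC; case: (_ != 0).
have hC : h n = (lead_coef (h n))%:P.
  have /size1_polyC {1}-> : (size (h n) <= 1)%N.
    by move: j0; rewrite /j; case: (size (h n)) => [|[]].
  by rewrite lead_coefE -/j j0.
case: top => _; rewrite j0 coefXM /= coefC /= mulr0z subr0 mulr1z.
move/(mulfI (_ : n%:~R != 0)); rewrite intrA_eq0 => /(_ n0) ->.
by rewrite mulrA -exprzDr ?lambda_unit // subrr expr0z mul1r.
Qed.
End WittDensities.

(** * Operators on F[s, t] *)

(* Unlike in poly2, s is here the outer variable 'X and t the inner one 'X%:P, *)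
(* so that the degree in s is a size; swapXY exchanges the two conventions.    *)
Section ShiftIntertwiners.
Variable F : fieldType.
Local Notation P := {poly {poly F}}.
Local Notation dt := (map_poly deriv : P -> P).
Implicit Types (f g : P).

Lemma poly_shiftX n : poly_shift n ('X : P) = 'X - n%:~R%:P.
Proof. exact: comp_polyX. Qed.

Lemma poly_shiftC n (c : {poly F}) : poly_shift n c%:P = c%:P.
Proof. exact: comp_polyC. Qed.

Lemma poly_shiftD n f g : poly_shift n (f + g) = poly_shift n f + poly_shift n g.
Proof. exact: comp_polyD. Qed.

Lemma poly_shiftM n f g : poly_shift n (f * g) = poly_shift n f * poly_shift n g.
Proof. exact: comp_polyM. Qed.

Lemma dtD f g : dt (f + g) = dt f + dt g.
Proof. exact: raddfD. Qed.

Lemma dtC (c : {poly F}) : dt c%:P = c^`()%:P.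
Proof.
apply/polyP=> i; rewrite coef_map_id0 ?linear0 // !coefC.
by case: i => //= i; rewrite linear0.
Qed.

Lemma dtM f g : dt (f * g) = dt f * g + f * dt g.
Proof.
apply/polyP=> i; rewrite coef_map_id0 ?linear0 // coefD !coefM.
rewrite linear_sum -big_split; apply: eq_bigr => j _ /=.
by rewrite derivM !coef_map_id0 ?linear0.
Qed.

Lemma dtX : dt 'X = 0.
Proof.
apply/polyP=> i; rewrite coef_map_id0 ?linear0 // coefX coef0.
by case: (i == _); rewrite /= ?derivC.
Qed.

Lemma dt_shift n f : dt (poly_shift n f) = poly_shift n (dt f).
Proof.
elim/poly_ind: f => [|f d IH]; first by rewrite raddf0 /poly_shift rmorph0 raddf0.
rewrite !(poly_shiftD, poly_shiftM, poly_shiftX, poly_shiftC, dtD, dtC, dtM, dtX) IH.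
by rewrite -polyC_int -polyCN dtC -polyCN derivC polyC0 addr0.
Qed.

Variables (n : int) (T : P -> P) (e : P).
Hypothesis TD : {morph T : f g / f + g}.
Hypothesis TZ : forall c f, T (c%:P%:P * f) = c%:P%:P * T f.
Hypothesis Ts : forall f, T ('X * f) = ('X - n%:~R%:P) * T f.
Hypothesis Tt : forall f, T ('X%:P * f) = 'X%:P * T f + e * poly_shift n f.

(** The operator [e * poly_shift n (dt f)] has the same commutators with [s] and [t] as [T]. What
    remains is linear over [F[s, t]] up to the shift, hence determined by its value at 1. *)
Lemma shift_intertwiner f :
  T f = poly_shift n f * T 1 + e * poly_shift n (dt f).
Proof.
have T0 : T 0 = 0 by apply: (addrI (T 0)); rewrite -TD !addr0.
elim/poly_ind: f => [|f d IH].
  by rewrite T0 raddf0 /poly_shift !rmorph0 mulr0 mul0r addr0.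
rewrite TD mulrC Ts IH.
rewrite !(poly_shiftD, poly_shiftM, poly_shiftX, poly_shiftC, dtD, dtC, dtM, dtX).
have -> : T d%:P = d%:P * T 1 + e * d^`()%:P.
  elim/poly_ind: d => [|d c IHd].
    by rewrite T0 linear0 mulr0 mul0r addr0.
  rewrite polyCD TD polyCM mulrC Tt IHd derivD derivM derivX derivC.
  have -> : T c%:P%:P = c%:P%:P * T 1 by rewrite -TZ mulr1.
  by rewrite poly_shiftC !(polyCD, polyCM) ; ring.
ring.
Qed.

End ShiftIntertwiners.

(** * Determining the action on [F[s, t]] *)

Section Classification.
Variable F : fieldType.
Hypothesis intrF_eq0 : forall n : int, (n%:~R == 0 :> F) = (n == 0).
Local Notation P := {poly {poly F}}.
Local Notation C c := (c%:P%:P : P).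
Local Notation dt := (map_poly deriv : P -> P).
Local Notation s := ('X : P).
Local Notation t := ('X%:P : P).
Local Notation sh := (@poly_shift {poly F}).

Variable w : WH4_letter -> int -> P -> P.
Hypothesis wD : forall x n, {morph w x n : f h / f + h}.
Hypothesis wZ : forall x n c f, w x n (C c * f) = C c * w x n f.
Hypothesis wL0 : forall f, w LL 0 f = s * f.
Hypothesis wa0 : forall f, w La 0 f = t * f.
Hypothesis wP : forall x y m n f, w x m (w y n f) - w y n (w x m f) =
  C (WH4_coef F x y m n) * w (WH4_target x y) (m + n) f.
(** Simplicity, for submodules that are principal ideals of [F[s, t]]: such an ideal is zero or
    contains 1. *)
Hypothesis w_simple : forall q,
  (forall x n f, exists h, w x n (q * f) = q * h) -> q = 0 \/ exists h, q * h = 1.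

Let intrF : forall n : int, (n%:~R == 0 :> {poly F}) = (n == 0).
Proof. by move=> n; rewrite -polyC_int polyC_eq0 intrF_eq0. Qed.

Let Cint (n : int) : C n%:~R = n%:~R%:P.
Proof. by rewrite polyC_int. Qed.

Let deriv_eq0 (f : {poly F}) : f^`() = 0 -> f = (f`_0)%:P.
Proof.
move=> f0; apply/polyP=> -[|i]; rewrite coefC //=.
have /eqP := congr1 (fun h : {poly F} => h`_i) f0.
rewrite coef_deriv coef0 -mulr_natr mulf_eq0 -[i.+1%:R]/(i.+1%:Z%:~R) intrF_eq0.
by rewrite orbF => /eqP.
Qed.

Let ws x n f : w x n (s * f) = (s - n%:~R%:P) * w x n f.
Proof.
have := wP LL x 0 n f; rewrite !wL0 add0r.
have -> : WH4_coef F LL x 0 n = n%:~R by case: x; rewrite /= ?subr0.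
have -> : WH4_target LL x = x by case: x.
by rewrite Cint mulrBl => <-; rewrite opprB addrC subrK.
Qed.

Let wt0 x n f : WH4_coef F La x 0 n = 0 -> w x n (t * f) = t * w x n f + 0 * sh n f.
Proof.
move=> c0; have := wP La x 0 n f; rewrite !wa0 c0 !mul0r => /eqP.
by rewrite subr_eq0 addr0 => /eqP.
Qed.

Let w0E x n f : WH4_coef F La x 0 n = 0 -> w x n f = sh n f * w x n 1.
Proof.
move=> c0; rewrite (shift_intertwiner (wD x n) (wZ x n) (ws x n) (e := 0)).
  by rewrite mul0r addr0.
by move=> h; exact: wt0.
Qed.

Let wLE n f : w LL n f = sh n f * w LL n 1.
Proof. by apply: w0E; rewrite /= oppr0. Qed.
Let waE n f : w La n f = sh n f * w La n 1. Proof. exact: w0E. Qed.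
Let wcE n f : w Lc n f = sh n f * w Lc n 1. Proof. exact: w0E. Qed.

(** The derivative term comes from [[a_0, b_n] = c_n]; for [d_n] it comes from [[a_0, d_n] = -
    a_n]. *)
Let wbE n f : w Lb n f = sh n f * w Lb n 1 - w Lc n 1 * sh n (dt f).
Proof.
rewrite -mulNr; apply: shift_intertwiner (wD Lb n) (wZ Lb n) (ws Lb n) _ _ => h.
have := wP La Lb 0 n h; rewrite !wa0 add0r /= mul1r wcE => E.
by rewrite mulNr mulrC [w Lc n 1 * _]mulrC -E opprB addrC subrK mulrC.
Qed.

Let wdE n f : w Ld n f = sh n f * w Ld n 1 + w La n 1 * sh n (dt f).
Proof.
apply: shift_intertwiner (wD Ld n) (wZ Ld n) (ws Ld n) _ _ => h.
have := wP La Ld 0 n h; rewrite !wa0 add0r /= !polyCN mulN1r waE => E.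
by rewrite [w La n 1 * _]mulrC -[sh n h * _]opprK -E opprB addrC subrK.
Qed.

Let sh0 f : sh 0 f = f.
Proof. by rewrite /poly_shift subr0 comp_polyXr. Qed.

Let shz n : sh n 0 = 0. Proof. exact: poly_shiftC. Qed.

(** [witt_rank1] over [A = F[t]] gives a unit [lambda] of [F[t]], which is a nonzero scalar; [alpha]
    may still depend on [t]. *)
Let exists_lambda_alpha : exists (lambda : F) (alpha : {poly F}), lambda != 0 /\
  forall n, w LL n 1 = (lambda ^ n)%:P%:P * (s + (n%:~R * alpha)%:P).
Proof.
have [|m n|lam [alpha [lam_unit lE]]] := witt_rank1 intrF (l := fun n => w LL n 1).
- by rewrite wL0 mulr1.
- have := wP LL LL m n 1; rewrite /= (wLE m (w LL n 1)) (wLE n (w LL m 1)) Cint polyC_int.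
  move=> E; rewrite -E; congr (_ - _); exact: mulrC.
move: lam_unit lE; rewrite poly_unitE => /andP[/size_poly1P[c c0 ->] _] lE.
exists c, alpha; split=> // n; rewrite lE -rmorphXz ?unitfE //.
Qed.

Lemma WH4_rank1_action : exists (alpha gamma beta lambda : F) (g : {poly F}),
  [/\ beta != 0, lambda != 0 & forall x n f, w x n f =
    Omega_formula (fun c : F => C c) sh dt alpha beta gamma lambda s t g%:P (x, n) f].
Proof.
have [lam [al [lam0 lE]]] := exists_lambda_alpha.
pose lamP := lam%:P : {poly F}.
have lamP_unit : lamP \is a GRing.unit.
  by rewrite poly_unitE size_polyC lam0 coefC /= unitfE.
have lamX (n : int) : lamP ^ n = (lam ^ n)%:P.
  by rewrite -rmorphXz ?unitfE.
have lE' (n : int) : w LL n 1 = (lamP ^ n)%:P * (s + (n%:~R * al)%:P).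
  by rewrite lE lamX.
have density (h : int -> P) :
    (forall m n, w LL m 1 * sh m (h n) - h n * sh n (w LL m 1) = n%:~R * h (m + n)) ->
    forall n, h n = (C (lam ^ n)) * ((h 0)`_0)%:P.
  move=> hP n; rewrite (witt_density intrF lamP_unit (alpha := al) (h := h)).
    by rewrite lamX polyCM.
  by move=> m k; rewrite -lE' hP.
(* The term [w x n (w LL m 1)] is left unexpanded: for [b] and [d] it contains the t-derivative of
   [L_m 1], an obstacle to applying [density]. *)
have brL x m n : x != LL ->
    sh m (w x n 1) * w LL m 1 - w x n (w LL m 1) = n%:~R * w x (m + n) 1.
  move=> xL; have := wP LL x m n 1; rewrite -(wLE m) => ->.
  by rewrite -[n%:~R]polyC_int -Cint; case: x xL.
have aE n : w La n 1 = C (lam ^ n) * t.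
  rewrite (density (fun n => w La n 1)) => [|m k].
    by rewrite wa0 mulr1 coefC.
  by rewrite -(brL La m k isT) [w La k (w LL m 1)]waE mulrC [sh k _ * _]mulrC.
have [c cE] : exists c : {poly F}, forall n, w Lc n 1 = C (lam ^ n) * c%:P.
  exists (w Lc 0 1)`_0; apply: (density (fun n => w Lc n 1)) => m k.
  by rewrite -(brL Lc m k isT) [w Lc k (w LL m 1)]wcE mulrC [sh k _ * _]mulrC.
have c0E f : w Lc 0 f = c%:P * f.
  by rewrite wcE sh0 cE mulrC mul1r.
have c_comm x n f : w x n (c%:P * f) = c%:P * w x n f.
  have := wP Lc x 0 n f; rewrite !c0E.
  have -> : WH4_coef F Lc x 0 n = 0 by case: x; rewrite //= oppr0.
  by rewrite polyC0 mul0r => /eqP; rewrite subr_eq0 => /eqP.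
(* Since [c_0] is central, the multiples of [c] form a submodule, so [c] is zero or a unit. *)
have [/eqP|[h ch1]] : c%:P = 0 :> P \/ exists h, c%:P * h = 1.
- by apply: w_simple => x n f; exists (w x n f).
- (* c_n = 0 for all n, so tM is a proper submodule. *)
  rewrite polyC_eq0 => /eqP c0.
  have [x n f||[h]] := w_simple (q := t).
  + case: x.
    * by exists (w LL n f); rewrite wt0 ?mul0r ?addr0 //= oppr0.
    * by exists (w La n f); rewrite wt0 // mul0r addr0.
    * exists (sh n f * w Lb n 1); rewrite wbE cE c0 polyC0 mulr0 mul0r subr0.
      by rewrite poly_shiftM poly_shiftC mulrA.
    * by exists (w Lc n f); rewrite wt0 // mul0r addr0.
    (* The derivative term of [d_n] carries the factor [a_n 1 = lambda^n t], so it stays in [tM]. *)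
    * rewrite wdE aE; exists (sh n f * w Ld n 1 + C (lam ^ n) * sh n (dt (t * f))).
      by rewrite poly_shiftM poly_shiftC; ring.
  + by move/eqP; rewrite polyC_eq0 polyX_eq0.
  + move/(congr1 (fun f : P => f`_0`_0)); rewrite coefCM coefXM coef1 /= coef1 /=.
    by move/eqP; rewrite eq_sym oner_eq0.
have [beta [beta0 {}cE]] : exists beta, beta != 0 /\ forall n, w Lc n 1 = - C (lam ^ n * beta).
  have : c%:P \is a @GRing.unit P by apply/unitrPr; exists h.
  rewrite poly_unitE coefC /= poly_unitE => /and3P[_ /size_poly1P[b b0 cb] _].
  exists (- b); rewrite oppr_eq0; split=> // n.
  by rewrite cE cb !polyCM !polyCN; ring.
(* By [L_1, b_0] 1 = 0, the Witt bracket of L_1 1 and b_0 1 is lambda beta      *)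
(* alpha'(t); such a bracket has positive degree in s unless it vanishes.      *)
have al'0 : al^`() = 0.
  have := brL Lb 1 0 isT; rewrite [w Lb 0 (w LL 1 1)]wbE !sh0 mul0r cE mul1r lE'.
  have -> : dt ((lamP ^ 1)%:P * (s + (1%:~R * al)%:P)) = (lamP * al^`())%:P.
    by rewrite !(dtM, dtD, dtC, dtX) expr1z derivC mul1r polyCM polyC0 mul0r !add0r.
  set B := w Lb 0 1; set l := _ * (s + _) => E.
  have [||_ /eqP] := @witt_invariant_const _ lamP al intrF lamP_unit
      (beta%:P * (lamP * al^`()))%:P B.
  - by rewrite size_polyC leq_b1.
  - apply/eqP; rewrite -subr_eq0 -[X in _ == X]E -/l [X in _ - X == _]polyCM.
    by apply/eqP; ring.
  rewrite polyC_eq0 !mulf_eq0 !polyC_eq0 (negbTE beta0) (negbTE lam0).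
  by move/eqP.
have [a alE] : exists a, al = a%:P.
  exists al`_0; exact: deriv_eq0.
(* With [alpha] constant, the derivative terms of [b_k] and [d_k] vanish on [L_m 1], and [density]
   applies to both families. *)
have dtl n : dt (w LL n 1) = 0.
  by rewrite lE alE -polyC_int -polyCM !(dtM, dtD, dtC, dtX) !derivC addr0 mulr0 mul0r addr0.
have [g gE] : exists g : {poly F}, forall n, w Lb n 1 = C (lam ^ n) * g%:P.
  exists (w Lb 0 1)`_0; apply: (density (fun n => w Lb n 1)) => m k.
  rewrite -(brL Lb m k isT) [w Lb k (w LL m 1)]wbE dtl shz mulr0 subr0.
  by rewrite mulrC [sh k _ * _]mulrC.
have [d dE] : exists d : {poly F}, forall n, w Ld n 1 = C (lam ^ n) * d%:P.
  exists (w Ld 0 1)`_0; apply: (density (fun n => w Ld n 1)) => m k.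
  rewrite -(brL Ld m k isT) [w Ld k (w LL m 1)]wdE dtl shz mulr0 addr0.
  by rewrite mulrC [sh k _ * _]mulrC.
(* Evaluated at 1, [[d_0, b_0] = - b_0] reads [(t g)' = beta d'], so [beta d - t g] is a constant,
   which is [gamma]. *)
have [gam gamE] : exists gam : F, beta%:P * d = 'X * g + gam%:P.
  have E : 'X * g^`() + g = beta%:P * d^`().
    have := wP Ld Lb 0 0 1; rewrite (wdE 0 (w Lb 0 1)) (wbE 0 (w Ld 0 1)) !sh0.
    rewrite (gE 0) (dE 0) (aE 0) (cE 0) /= !expr0z !polyC1 !mul1r !dtC !polyCN polyC1.
    move=> E; apply: polyC_inj; rewrite polyCD !polyCM; apply/eqP.
    by rewrite -subr_eq0; move/eqP: E; rewrite -subr_eq0 => /eqP<-; apply/eqP; ring.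
  pose r := beta%:P * d - 'X * g; have rE : r = (r`_0)%:P.
    apply: deriv_eq0; rewrite /r derivB !derivM derivC derivX mul0r mul1r add0r.
    by apply/eqP; rewrite subr_eq0 -E addrC.
  by exists r`_0; rewrite -rE /r addrC subrK.
exists a, gam, beta, lam, g; split=> // x n f.
have dE' : C (lam ^ n) * d%:P = C (lam ^ n * beta^-1) * (t * g%:P + C gam).
  have -> : t * g%:P + C gam = C beta * d%:P by rewrite -[RHS]polyCM gamE polyCD polyCM.
  by rewrite mulrA -!polyCM -mulrA mulVf // mulr1.
have Cint' : (n%:~R * a%:P)%:P = C (n%:~R * a) by rewrite -polyC_int -polyCM.
case: x; rewrite /Omega_formula ?dt_shift.
- by rewrite wLE lE alE Cint' mulrC mulrA.
- by rewrite waE aE mulrC mulrA.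
- rewrite wbE gE cE (_ : C (lam ^ n * beta) = C (lam ^ n) * C beta) ?polyCM //.
  by rewrite mulNr opprK mulrC mulrA.
- by rewrite wcE cE mulrC !polyCN.
- by rewrite wdE dE dE' aE [in LHS]mulrC !mulrA.
Qed.

End Classification.

(** * Modules over the enveloping algebra *)

Lemma malg_ind (F : fieldType) (K : choiceType) (Q : {malg F[K]} -> Prop) :
  Q 0 -> (forall c g h, Q g -> Q h -> Q (c *: g + h)) ->
  (forall k, Q << k >>) -> forall g, Q g.
Proof.
move=> Q0 QD QU g; rewrite [g]monalgE; elim/big_rec: _ => // k h _ Qh.
by rewrite malgZU; apply: QD.
Qed.

Lemma env_ind (F : fieldType) (L : lieAlgType F) (Q : enveloping L -> Prop) :
  Q 0 -> Q 1 -> (forall c u v, Q u -> Q v -> Q (c *: u + v)) ->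
  (forall x u, Q u -> Q (env_inj x * u)) -> forall u, Q u.
Proof.
move=> Q0 Q1 QD QM u; have [p ->] := env_piW u; rewrite -!/(env_pi _).
elim/malg_ind: p => [|c p q Qp Qq|w]; first by rewrite linear0.
  by rewrite linearP; apply: QD.
case: w => s; elim: s => [|x s IH].
  have -> : << FMonom [::] >> = 1 :> free_algebra F L.
    by rewrite -[FMonom _]fmoneE.
  by rewrite rmorph1.
have -> : << FMonom (x :: s) >> = free_var F x * << FMonom s >>.
  by rewrite [RHS]fgmulUU mul1r; congr << _ >>; apply/val_inj; rewrite /= fmM fmU.
by rewrite rmorphM; apply: QM.
Qed.

Lemma enveloping_module_scale_alg (F : fieldType) (L : lieAlgType F) (V : lmodType F)
    (rho : L -> V -> V) (rhoP : lie_action rho) (c : F) (v : enveloping_module rhoP) :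
  (c%:A : enveloping L) *: v = c *: (v : V).
Proof.
have -> : c%:A = env_pi (c *: 1) :> enveloping L by rewrite linearZ rmorph1.
rewrite env_pi_scale; transitivity (c *: free_act rho 1 v); last by rewrite free_act1.
exact: (linearZ_LR (linext ((word_act rho)^~ v)) c 1).
Qed.

Lemma scale_commutator (A : pzRingType) (M : lmodType A) (a b c d : A) (v : M) :
  a * b - b * a = c * d -> a *: (b *: v) - b *: (a *: v) = c *: (d *: v).
Proof. by move=> abcd; rewrite !scalerA -scalerBl abcd. Qed.

Section WH4Modules.
Variable F : fieldType.
Local Notation U := (enveloping (WH4 F)).
Local Notation e x n := (env_inj (WH4_basis F x n) : U).

Lemma WH4_ind (Q : WH4 F -> Prop) :
  Q 0 -> (forall c u v, Q u -> Q v -> Q (c *: u + v)) ->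
  (forall x n, Q (WH4_basis F x n)) -> forall u, Q u.
Proof. by move=> Q0 QD QB; apply: malg_ind => // -[x n]; exact: QB. Qed.

Lemma WH4_env_ind (Q : U -> Prop) :
  Q 0 -> Q 1 -> (forall c u v, Q u -> Q v -> Q (c *: u + v)) ->
  (forall x n u, Q u -> Q (e x n * u)) -> forall u, Q u.
Proof.
move=> Q0 Q1 QD QM; apply: env_ind => // x u Qu.
elim/WH4_ind: x => [|c x y Qx Qy|x n]; last exact: QM.
  by rewrite linear0 mul0r.
by rewrite (linearP (@env_inj F (WH4 F))) mulrDl -env_scaleAl; exact: (QD c _ _ Qx Qy).
Qed.

Lemma WH4_env_bracket x y (m n : int) :
  e x m * e y n - e y n * e x m = WH4_coef F x y m n *: e (WH4_target x y) (m + n).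
Proof. by rewrite -env_inj_lie WH4_lie_basis WH4_bracketE linearZ. Qed.

Lemma WH4_module_bracket (M : lmodType U) x y (m n : int) (v : M) :
  e x m *: (e y n *: v) - e y n *: (e x m *: v) =
  ((WH4_coef F x y m n)%:A : U) *: (e (WH4_target x y) (m + n) *: v).
Proof.
by apply: scale_commutator; rewrite mulr_algl; exact: WH4_env_bracket.
Qed.

(** A module over [U] has no separate [F]-module structure here, so scalars of [F] act through
    [c%:A]. Scalars and the [x_n] generate [U], which makes [h] linear over [U]. *)
Lemma WH4_isomorphic (M N : lmodType U) (h : M -> N) :
  bijective h -> {morph h : u v / u + v} ->
  (forall (c : F) v, h ((c%:A : U) *: v) = (c%:A : U) *: h v) ->
  (forall x n v, h (e x n *: v) = e x n *: h v) -> isomorphic M N.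
Proof.
move=> hbij hD hZ he; have h0 : h 0 = 0 by apply: (addrI (h 0)); rewrite -hD !addr0.
have hU (u : U) v : h (u *: v) = u *: h v.
  elim/WH4_env_ind: u v => [|||x n u IH] v.
  - by rewrite !scale0r.
  - by rewrite !scale1r.
  - move=> u1 u2 IH1 IH2 v1; rewrite !scalerDl hD IH2; congr (_ + _).
    by rewrite -mulr_algl -!scalerA hZ IH1.
  - by rewrite -!scalerA he IH.
have h_lin : linear h by move=> u v v'; rewrite hD hU.
pose hL : {linear M -> N} := HB.pack h (GRing.isLinear.Build U M N *:%R h h_lin).
by exists hL.
Qed.

Lemma simple_WH4_module (M : lmodType U) (Q : M -> Prop) :
  simple_module M -> Q 0 -> (forall u v, Q u -> Q v -> Q (u + v)) ->
  (forall (c : F) v, Q v -> Q ((c%:A : U) *: v)) ->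
  (forall x n v, Q v -> Q (e x n *: v)) ->
  (forall v, Q v -> v = 0) \/ forall v, Q v.
Proof.
move=> [_ simpleM] Q0 QD QZ Qe.
have QU (u : U) v : Q v -> Q (u *: v).
  elim/WH4_env_ind: u v => [||c u1 u2 IH1 IH2|x n u IH] v Qv.
  - by rewrite scale0r.
  - by rewrite scale1r.
  - rewrite scalerDl; apply: QD; last exact: IH2.
    by rewrite -mulr_algl -scalerA; apply/QZ/IH1.
  - by rewrite -scalerA; apply/Qe/IH.
have [|SQ|SQ] := simpleM (fun v => `[< Q v >]).
- split; first exact/asboolP.
  by move=> u v v' /asboolP Qv /asboolP Qv'; apply/asboolP/QD => //; apply: QU.
- left=> v Qv; apply/eqP; have := SQ v; rewrite !inE => <-; exact/asboolP.
- by right=> v; apply/asboolP; have := SQ v; rewrite !inE.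
Qed.

End WH4Modules.

(** * Passing from [s] outer to [t] outer *)

Section SwapXY.
Variable F : fieldType.
Local Notation P := {poly {poly F}}.

Lemma swapXY_polyCC (c : F) : swapXY (c%:P%:P : P) = c%:P%:P.
Proof. by rewrite swapXY_polyC map_polyC. Qed.

Lemma swapXY_shift n (f : P) : swapXY (poly_shift n f) = poly2_shift n (swapXY f).
Proof.
have sX : swapXY ('X - n%:~R%:P : P) = ('X - n%:~R%:P)%:P.
  by rewrite -(polyC_int F n) -!polyCN (rmorphD swapXY) /= swapXY_X swapXY_polyCC polyCD.
pose S : {rmorphism P -> P} := map_poly (comp_poly ('X - n%:~R%:P : {poly F})).
rewrite -[poly2_shift n _]/(S (swapXY f)).
elim/poly_ind: f => [|f c IH]; first by rewrite /poly_shift !rmorph0.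
rewrite poly_shiftD poly_shiftM poly_shiftX poly_shiftC.
rewrite !(rmorphD swapXY) !(rmorphM swapXY) /= sX IH (rmorphD S) (rmorphM S).
rewrite swapXY_X swapXY_polyC; congr (_ * _ + _).
  by rewrite /S /= map_polyC /= comp_polyX.
by apply/polyP=> i; rewrite !coef_map /= comp_polyC.
Qed.

Lemma swapXY_dt (f : P) : swapXY (map_poly deriv f) = (swapXY f)^`().
Proof.
apply/polyP=> i; apply/polyP=> j.
by rewrite coef_swapXY coef_map_id0 ?linear0 // !coef_deriv coefMn coef_swapXY.
Qed.

Lemma swapXY_Omega (alpha beta gamma lambda : F) (g : {poly F}) p (f : P) :
  swapXY (Omega_formula (fun c : F => c%:P%:P : P) (@poly_shift _) (map_poly deriv)
    alpha beta gamma lambda 'X 'X%:P g%:P p f) =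
  Omega_basis alpha beta gamma lambda g p (swapXY f).
Proof.
have sD f1 f2 : swapXY (f1 + f2 : P) = swapXY f1 + swapXY f2 by exact: rmorphD.
have sM f1 f2 : swapXY (f1 * f2 : P) = swapXY f1 * swapXY f2 by exact: rmorphM.
have scaleE c (h : poly2 F) : c *: h = c%:P%:P * h by [].
case: p => x n; case: x; rewrite /Omega_formula /Omega_basis !scaleE;
  rewrite !(sD, sM, swapXY_dt, swapXY_shift, swapXY_polyCC, swapXY_X, swapXY_Y);
  by rewrite ?swapXY_polyC.
Qed.

End SwapXY.

(** * [U(B)] as a polynomial ring *)

Section RankOne.
Variable F : fieldType.
Local Notation U := (enveloping (WH4 F)).
Local Notation e x n := (env_inj (WH4_basis F x n) : U).
Local Notation P := {poly {poly F}}.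
Local Notation UB := (enveloping (WH4_B F)).

Fact WH4_L0_in_B : WH4_basis F LL 0 \in span2 (WH4_basis F LL 0) (WH4_basis F La 0).
Proof. by apply/asboolP; exists 1, 0; rewrite scale1r scale0r addr0. Qed.

Fact WH4_a0_in_B : WH4_basis F La 0 \in span2 (WH4_basis F LL 0) (WH4_basis F La 0).
Proof. by apply/asboolP; exists 0, 1; rewrite scale1r scale0r add0r. Qed.

Let LB : WH4_B F := Sub (WH4_basis F LL 0) WH4_L0_in_B.
Let aB : WH4_B F := Sub (WH4_basis F La 0) WH4_a0_in_B.

Let B_span (x : WH4_B F) : exists c d, x = c *: LB + d *: aB.
Proof.
have /asboolP[c [d xE]] := valP x; exists c, d; apply: val_inj.
by rewrite [RHS](linearP (WH4_B_incl F)) (linearZ_LR (WH4_B_incl F)).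
Qed.

Let comm_LB (p : {poly F}) : GRing.comm (env_inj LB) (horner_alg (env_inj aB) p).
Proof.
have La_comm : GRing.comm (env_inj LB) (env_inj aB).
  apply/eqP; rewrite -subr_eq0 -env_inj_lie.
  have -> : lie LB aB = 0 by apply: val_inj; rewrite sublie_val WH4_B_comm.
  by rewrite linear0.
elim/poly_ind: p => [|p c IH]; first by rewrite rmorph0; exact: commr0.
rewrite rmorphD rmorphM /= horner_algX horner_algC.
by apply: commrD; [apply: commrM|apply/commr_sym/comm_alg].
Qed.

(** The morphism [F[s, t] -> U(B)] with [s] sent to [L_0] and [t] to [a_0]; it exists because these
    commute ([comm_LB]). *)
Let theta : {rmorphism P -> UB} := horner_morph comm_LB.

Let thetaX : theta 'X = env_inj LB. Proof. exact: horner_morphX. Qed.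
Let thetaY : theta 'X%:P = env_inj aB.
Proof. by rewrite /theta /= horner_morphC /= horner_algX. Qed.
Let thetaC c : theta c%:P%:P = c%:A.
Proof. by rewrite /theta /= horner_morphC /= horner_algC. Qed.

Let thetaD f h : theta (f + h) = theta f + theta h. Proof. exact: rmorphD. Qed.
Let thetaM f h : theta (f * h) = theta f * theta h. Proof. exact: rmorphM. Qed.

Let theta_surj u : exists f, theta f = u.
Proof.
elim/env_ind: u => [||c u v [f <-] [h <-]|x u [f <-]].
- by exists 0; rewrite rmorph0.
- by exists 1; rewrite rmorph1.
- by exists (c%:P%:P * f + h); rewrite thetaD thetaM thetaC mulr_algl.
have [c [d ->]] := B_span x; exists ((c%:P%:P * 'X + d%:P%:P * 'X%:P) * f).
rewrite thetaM thetaD (thetaM _ 'X) (thetaM _ 'X%:P) !thetaC thetaX thetaY.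
congr (_ * _); rewrite linearP linearZ; congr (_ + _); exact: mulr_algl.
Qed.

Local Notation incl := (env_map (@WH4_B_incl_lie F)).

Let incl_inj (x : WH4_B F) : incl (env_inj x) = env_inj (val x).
Proof. exact: env_lift_inj. Qed.

Let inclA c : incl c%:A = c%:A.
Proof. by rewrite linearZ rmorph1. Qed.

(* L_0 and a_0 act on Omega(0, 1, 0, 1, 0) by multiplication by s and t, so     *)
(* theta is injective.                                                         *)
Let theta_inj : injective theta.
Proof.
have one0 : 1 != 0 :> F by exact: oner_neq0.
pose N := Omega 0 1 0 1 0 one0 one0.
have sh0 (h : poly2 F) : poly2_shift 0 h = h.
  by rewrite /poly2_shift map_poly_id // => c _; rewrite subr0 comp_polyXr.
have actL (h : poly2 F) : e LL 0 *: (h : N) = 'X%:P * h.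
  by rewrite Omega_basisZ /Omega_basis expr0z scale1r sh0 mul0r addr0.
have acta (h : poly2 F) : e La 0 *: (h : N) = 'X * h.
  by rewrite Omega_basisZ /Omega_basis expr0z scale1r sh0.
have actC c (h : poly2 F) : (c%:A : U) *: (h : N) = c%:P%:P * h.
  exact: enveloping_module_scale_alg.
pose act (f : P) (h : N) : N := incl (theta f) *: h.
have actD f1 f2 h : act (f1 + f2) h = act f1 h + act f2 h.
  by rewrite /act thetaD (rmorphD incl) scalerDl.
have actM f1 f2 h : act (f1 * f2) h = act f1 (act f2 h).
  by rewrite /act thetaM (rmorphM incl) scalerA.
have act0 h : act 0 h = 0 by rewrite /act !rmorph0 scale0r.
have actE f (h : poly2 F) : act f h = swapXY f * h.
  elim/poly_ind: f h => [|f c IH] h; first by rewrite act0 rmorph0 mul0r.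
  rewrite actD actM IH rmorphD rmorphM /= swapXY_X mulrDl; congr (_ + _).
    by rewrite -mulrA; congr (_ * _); rewrite /act thetaX incl_inj actL.
  elim/poly_ind: c h => [|c d IHc] h; first by rewrite act0 rmorph0 mul0r.
  rewrite polyCD polyCM actD actM IHc rmorphD rmorphM /= swapXY_Y mulrDl; congr (_ + _).
    by rewrite -mulrA; congr (_ * _); rewrite /act thetaY incl_inj acta.
  by rewrite /act thetaC inclA actC swapXY_polyCC.
move=> f1 f2 f12; apply: (can_inj (@swapXYK F)).
by rewrite -[LHS]mulr1 -[RHS]mulr1 -!actE /act f12.
Qed.

Let theta_bij : bijective theta.
Proof.
have /choice[theta' theta'K] := theta_surj.
by exists theta' => // f; apply: theta_inj; rewrite theta'K.
Qed.

Lemma free_of_rank1_polynomials (M : lmodType U) :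
  free_of_rank1 (restriction incl M) ->
  exists psi : P -> M, [/\ bijective psi, {morph psi : f h / f + h},
    forall c f, psi (c%:P%:P * f) = (c%:A : U) *: psi f,
    forall f, psi ('X * f) = e LL 0 *: psi f &
    forall f, psi ('X%:P * f) = e La 0 *: psi f].
Proof.
move=> [phi phi_bij]; pose psi (f : P) : M := phi (theta f).
have psiM f h : psi (f * h) = incl (theta f) *: psi h.
  rewrite /psi thetaM; exact: (linearZ_LR phi (theta f) (theta h)).
exists psi; split.
- exact: bij_comp phi_bij theta_bij.
- by move=> f h; rewrite /psi thetaD; exact: (linearD phi).
- by move=> c f; rewrite psiM thetaC inclA.
- by move=> f; rewrite psiM thetaX incl_inj.
- by move=> f; rewrite psiM thetaY incl_inj.
Qed.

End RankOne.

(** * Transport to the given module *)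

Section SimpleRankOne.

Local Notation e x n := (env_inj (WH4_basis _ x n)).

Lemma simple_rank1_isomorphic_Omega (F : fieldType) (M : lmodType (enveloping (WH4 F))) :
  (forall n : int, (n%:~R == 0 :> F) = (n == 0)) -> simple_module M ->
  free_of_rank1 (restriction (env_map (@WH4_B_incl_lie F)) M) ->
  exists (alpha gamma beta lambda : F) (g : {poly F})
         (beta_neq0 : beta != 0) (lambda_neq0 : lambda != 0),
    isomorphic M (Omega alpha beta gamma lambda g beta_neq0 lambda_neq0).
Proof.
move=> intrF_eq0 simpleM /free_of_rank1_polynomials[psi].
move=> [[psi' psiK psi'K] psiD psiZ psis psit].
pose U := enveloping (WH4 F); pose P := {poly {poly F}}.
pose w x n (f : P) : P := psi' (e x n *: psi f).
have psi'D u v : psi' (u + v) = psi' u + psi' v.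
  by rewrite -[u in LHS]psi'K -[v in LHS]psi'K -psiD psiK.
have psi'B u v : psi' (u - v) = psi' u - psi' v.
  by apply/eqP; rewrite eq_sym subr_eq -psi'D subrK.
have psi'Z (c : F) v : psi' ((c%:A : U) *: v) = c%:P%:P * psi' v.
  by rewrite -[v in LHS]psi'K -psiZ psiK.
have psi_w x n f : psi (w x n f) = e x n *: psi f by rewrite psi'K.
have psi0 : psi 0 = 0 by apply: (addrI (psi 0)); rewrite -psiD !addr0.
have eA x n (c : F) (v : M) : e x n *: ((c%:A : U) *: v) = (c%:A : U) *: (e x n *: v).
  by rewrite !scalerA mulr_algl mulr_algr.
have wD x n : {morph w x n : f h / f + h}.
  by move=> f h; rewrite /w psiD scalerDr psi'D.
have wZ x n c f : w x n (c%:P%:P * f) = c%:P%:P * w x n f.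
  by rewrite /w psiZ eA psi'Z.
have wL0 f : w LL 0 f = 'X * f by rewrite /w -psis psiK.
have wa0 f : w La 0 f = 'X%:P * f by rewrite /w -psit psiK.
have ww x y m n f : w x m (w y n f) = psi' (e x m *: (e y n *: psi f)).
  by rewrite {1}/w psi_w.
have wP x y m n f : w x m (w y n f) - w y n (w x m f) =
    (WH4_coef F x y m n)%:P%:P * w (WH4_target x y) (m + n) f.
  transitivity (psi' (e x m *: (e y n *: psi f)) - psi' (e y n *: (e x m *: psi f))).
    by congr (_ - _); exact: ww.
  apply: etrans (esym (psi'B _ _)) _; rewrite -psi'Z; congr psi'.
  exact: WH4_module_bracket.
have w_simple q : (forall x n f, exists h, w x n (q * f) = q * h) ->
    q = 0 \/ exists h, q * h = 1.
  (* [Q] is the image of the ideal generated by [q]. If it is zero, [psi (q * 1) = 0] gives [q = 0];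
     if it is everything, it contains [psi 1], so [q] divides 1. *)
  move=> wq; pose Q v := exists f, v = psi (q * f).
  have [||c|x n v [f ->]|Q0|QT] := @simple_WH4_module F M Q simpleM.
  - by exists 0; rewrite mulr0 psi0.
  - by move=> _ _ [f ->] [h ->]; exists (f + h); rewrite mulrDr psiD.
  - by move=> _ [f ->]; exists (c%:P%:P * f); rewrite mulrCA psiZ.
  - have [h hE] := wq x n f; exists h; by rewrite -hE psi_w.
  - left; apply: (can_inj psiK); rewrite psi0; apply: Q0; exists 1; by rewrite mulr1.
  - right; have [h hE] := QT (psi 1); exists h; apply: (can_inj psiK); by [].
have [alpha [gamma [beta [lambda [g [beta0 lambda0 wE]]]]]] :=
  WH4_rank1_action intrF_eq0 wD wZ wL0 wa0 wP w_simple.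
exists alpha, gamma, beta, lambda, g, beta0, lambda0.
pose N := Omega alpha beta gamma lambda g beta0 lambda0.
apply: (@WH4_isomorphic F M N (fun v => swapXY (psi' v))).
- exists (fun f : N => psi (swapXY f)) => v.
    by rewrite swapXYK psi'K.
  by rewrite psiK swapXYK.
- by move=> u v; rewrite psi'D (rmorphD swapXY).
- move=> c v; rewrite psi'Z (rmorphM swapXY) /= swapXY_polyCC.
  by symmetry; exact: enveloping_module_scale_alg.
- move=> x n v; rewrite Omega_basisZ -swapXY_Omega -wE /w psi'K //.
Qed.

End SimpleRankOne.

Theorem theorem3p4 (R : realType) (M : lmodType (enveloping (WH4 R[i]))) :
  simple_module M ->
  free_of_rank1 (restriction (env_map (@WH4_B_incl_lie R[i])) M) ->
  exists (alpha gamma beta lambda : R[i]) (g : {poly R[i]})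
         (beta_neq0 : beta != 0) (lambda_neq0 : lambda != 0),
    isomorphic M (Omega alpha beta gamma lambda g beta_neq0 lambda_neq0).
Proof.
by apply: simple_rank1_isomorphic_Omega => n; rewrite intr_eq0.
Qed.
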